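(* Consider bialgebras and Hopf algebras over the field $\mathbb{F}_2$ with two elements, counted up to isomorphism. (a) In dimensions $n=2,3,4$ the number of isomorphism classes of bialgebras of dimension $n$ over $\mathbb{F}_2$ is $4$, $24$, $286$ respectively (314 in total). (b) In dimensions $n=2,3,4$ the number of isomorphism classes of Hopf algebras of dimension $n$ over $\mathbb{F}_2$ is $3$, $2$, $20$ respectively (25 in total). (c) For $n=2,3,4$, choosing one representative $H$ from each isomorphism class of $n$-dimensional Hopf algebras over $\mathbb{F}_2$, the number of pairs $(H,\mathcal{R})$ with $\mathcal{R}\neq 1\otimes 1$ a quasitriangular structure on $H$ is $1$, $0$, $28$ respectively.
   Context: All algebras are unital and associative and all coalgebras counital and coassociative. A bialgebra is a vector space $H$ that is an algebra and a coalgebra such that the coproduct $\Delta$ and counit $\epsilon$ are unital algebra homomorphisms; it is a Hopf algebra if it admits an antipode (which is then unique). An isomorphism of bialgebras or Hopf algebras is a linear bijection that is both an algebra and a coalgebra map. A quasitriangular structure on a Hopf algebra $H$ is an invertible $\mathcal{R}\in H\otimes H$ with $(\Delta\otimes\mathrm{id})\mathcal{R}=\mathcal{R}_{13}\mathcal{R}_{23}$, $(\mathrm{id}\otimes\Delta)\mathcal{R}=\mathcal{R}_{13}\mathcal{R}_{12}$ and $\mathcal{R}\,\Delta h=(\Delta^{cop}h)\,\mathcal{R}$ for all $h\in H$, where $\Delta^{cop}$ is $\Delta$ followed by the flip and suffixes denote the position in $H^{\otimes 3}$. In (c) quasitriangular structures on a fixed $H$ are counted as elements of $H\otimes H$ (not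 modulo automorphisms of $H$). *)

(* Defs.v *)
From HB Require Import structures.
From mathcomp Require Import all_boot all_order all_algebra all_field.
From mathcomp Require Import boolp.

Set Implicit Arguments.
Unset Strict Implicit.
Unset Printing Implicit Defensive.

Import GRing.Theory VectorInternalTheory.

Local Open Scope ring_scope.

Reserved Notation "u \ox v" (at level 40, left associativity).

(* V (x) W is modelled on the coordinate matrices in the bases underlying V   *)
(* and W.  The type is a fresh alias so that the product it receives below,   *)
(* (a (x) b) (c (x) d) = ac (x) bd, is not confused with that of matrices.    *)
Definition tensor (K : fieldType) (V W : vectType K) : Type :=
  'M[K]_(dim V, dim W).

HB.instance Definition _ (K : fieldType) (V W : vectType K) :=
  Vector.copy (tensor V W) 'M[K]_(dim V, dim W).

HB.instance Definition _ (K : finFieldType) (V W : vectType K) :=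
  Finite.copy (tensor V W) 'M[K]_(dim V, dim W).

Section Tensor.

Variable K : fieldType.
Implicit Types V W X : vectType K.

Definition pure_tensor V W (u : V) (v : W) : tensor V W :=
  \matrix_(i, j) (v2r u 0 i * v2r v 0 j).

Local Notation "u \ox v" := (pure_tensor u v) : ring_scope.

Definition basis_vec V (i : 'I_(dim V)) : V := r2v (delta_mx 0 i).

(* When b is bilinear, tlift b is the unique linear map such that             *)
(* tlift b (u (x) v) = b u v (lemmas tlift_pure, tlift_is_linear,             *)
(* tensor_ext); it is only meaningful for bilinear b.                         *)
Definition tlift V W (X : lmodType K) (b : V -> W -> X) (t : tensor V W) : X :=
  \sum_i \sum_j (t : 'M_(_, _)) i j *: b (basis_vec i) (basis_vec j).

Lemma vec_basis V (u : V) : u = \sum_i v2r u 0 i *: basis_vec i.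
Proof.
apply: v2r_inj; rewrite [LHS]row_sum_delta linear_sum.
by apply: eq_bigr => i _; rewrite linearZ /= /basis_vec r2vK.
Qed.

Lemma tensor_basis V W (t : tensor V W) :
  t = \sum_i \sum_j (t : 'M_(_, _)) i j *: (basis_vec i \ox basis_vec j).
Proof.
rewrite {1}(_ : t = \sum_i \sum_j
  (t : 'M_(_, _)) i j *: delta_mx i j :> 'M[K]_(dim V, dim W)); last first.
  exact: matrix_sum_delta.
apply: eq_bigr => i _; apply: eq_bigr => j _; congr (_ *: _).
apply/matrixP => k l; rewrite !mxE /basis_vec !r2vK !mxE /=.
by rewrite -natrM mulnb.
Qed.

Lemma pure_tensor_linear V W (v : W) a : linear (fun u : V => u \ox v) /\
  linear (fun w : W => a \ox w :> tensor V W).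
Proof.
split=> c x y; apply/matrixP => i j; rewrite !mxE !linearP /= !mxE.
  by rewrite mulrDl mulrA.
by rewrite mulrDr mulrCA.
Qed.

Lemma tlift_is_linear V W X (b : V -> W -> X) : linear (tlift b).
Proof.
move=> a s t; rewrite /tlift scaler_sumr -big_split; apply: eq_bigr => i _ /=.
rewrite scaler_sumr -big_split; apply: eq_bigr => j _ /=.
by rewrite !mxE scalerDl scalerA.
Qed.

Lemma tlift_linear_fun V W X (b b1 b2 : V -> W -> X) k t :
    (forall u v, b u v = k *: b1 u v + b2 u v) ->
  tlift b t = k *: tlift b1 t + tlift b2 t.
Proof.
move=> bE; rewrite /tlift scaler_sumr -big_split; apply: eq_bigr => i _ /=.
rewrite scaler_sumr -big_split; apply: eq_bigr => j _ /=.
by rewrite bE scalerDr !scalerA mulrC.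
Qed.

Lemma tlift_pure V W X (b : V -> W -> X) (u : V) (v : W) :
    (forall w, linear (b^~ w)) -> (forall x, linear (b x)) ->
  tlift b (u \ox v) = b u v.
Proof.
move=> bl br.
have bl_sum w I r (F : I -> V) : b (\sum_(i <- r) F i) w = \sum_(i <- r) b (F i) w.
  pose f := GRing.isLinear.Build _ _ _ _ (b^~ w) (bl w).
  by pose g : {linear V -> X} := HB.pack (b^~ w) f; apply: (linear_sum g).
have br_sum x I r (F : I -> W) : b x (\sum_(i <- r) F i) = \sum_(i <- r) b x (F i).
  pose f := GRing.isLinear.Build _ _ _ _ (b x) (br x).
  by pose g : {linear W -> X} := HB.pack (b x) f; apply: (linear_sum g).
have blZ w a x : b (a *: x) w = a *: b x w.
  pose f := GRing.isLinear.Build _ _ _ _ (b^~ w) (bl w).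
  by pose g : {linear V -> X} := HB.pack (b^~ w) f; apply: (linearZ_LR g).
have brZ x a w : b x (a *: w) = a *: b x w.
  pose f := GRing.isLinear.Build _ _ _ _ (b x) (br x).
  by pose g : {linear W -> X} := HB.pack (b x) f; apply: (linearZ_LR g).
rewrite [in RHS](vec_basis u) bl_sum; apply: eq_bigr => i _.
rewrite [in RHS](vec_basis v) br_sum; apply: eq_bigr => j _.
by rewrite blZ brZ scalerA mxE.
Qed.

Lemma tensor_ind V W (P : tensor V W -> Prop) :
    (forall u v, P (u \ox v)) ->
    (forall a s t, P s -> P t -> P (a *: s + t)) ->
  forall t, P t.
Proof.
move=> Pp Pl t.
have P0 : P 0.
  have -> : 0 = 0 \ox 0 :> tensor V W.
    by apply/matrixP => i j; rewrite !mxE linear0 mxE mul0r.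
  exact: Pp.
rewrite [t]tensor_basis; elim/big_ind: _ => //.
  by move=> x y Px Py; rewrite -[x]scale1r; apply: Pl.
move=> i _; elim/big_ind: _ => //.
  by move=> x y Px Py; rewrite -[x]scale1r; apply: Pl.
by move=> j _; rewrite -[_ *: _]addr0; apply: Pl.
Qed.

Lemma tensor_ext V W X (f g : tensor V W -> X) : linear f -> linear g ->
  (forall u v, f (u \ox v) = g (u \ox v)) -> f =1 g.
Proof.
by move=> fl gl fg; apply: tensor_ind => // a s t fs ft; rewrite fl gl fs ft.
Qed.

Definition tmap V W V' W' (f : V -> V') (g : W -> W') :
    tensor V W -> tensor V' W' :=
  tlift (fun u v => f u \ox g v).

Definition tswap V W : tensor V W -> tensor W V := tlift (fun u v => v \ox u).

Definition tassoc U V W :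
    tensor (tensor U V) W -> tensor U (tensor V W) :=
  tlift (fun s w => tlift (fun u v => u \ox (v \ox w)) s).

End Tensor.

Notation "u \ox v" := (pure_tensor u v) : ring_scope.

Section TensorAlgebra.

Variables (K : fieldType) (A B : falgType K).
Implicit Types (a c : A) (b d : B) (r s t : tensor A B).

Definition tone : tensor A B := 1 \ox 1.

Definition tmul s t : tensor A B :=
  tlift (fun a b => tlift (fun c d => (a * c) \ox (b * d)) t) s.

Lemma oxl b : linear (fun a => a \ox b).
Proof. exact: (pure_tensor_linear b (0 : A)).1. Qed.

Lemma oxr a : linear (fun b => a \ox b).
Proof. exact: (pure_tensor_linear (0 : B) a).2. Qed.

Lemma tmul_linear_l t : linear (tmul^~ t).
Proof. exact: tlift_is_linear. Qed.

Lemma tmul_linear_r s : linear (tmul s).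
Proof.
move=> k t1 t2; apply: tlift_linear_fun => a b; exact: tlift_is_linear.
Qed.

Lemma tmul_pure a b c d : tmul (a \ox b) (c \ox d) = (a * c) \ox (b * d).
Proof.
have inner x y : tlift (fun c d => (x * c) \ox (y * d)) (c \ox d)
    = (x * c) \ox (y * d).
  apply: tlift_pure => z k u v.
    by rewrite mulrDr -scalerAr oxl.
  by rewrite mulrDr -scalerAr oxr.
rewrite /tmul tlift_pure ?inner // => z k u v; rewrite !inner.
  by rewrite mulrDl -scalerAl oxl.
by rewrite mulrDl -scalerAl oxr.
Qed.

Lemma tmulA : associative tmul.
Proof.
move=> r s t; elim/tensor_ind: r => [a1 b1|k r1 r2 h1 h2]; last first.
  by rewrite !(tmul_linear_l _ k) h1 h2.
elim/tensor_ind: s => [a2 b2|k s1 s2 h1 h2]; last first.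
  by rewrite (tmul_linear_l _ k) !(tmul_linear_r _ k) (tmul_linear_l _ k) h1 h2.
elim/tensor_ind: t => [a3 b3|k t1 t2 h1 h2]; last first.
  by rewrite !(tmul_linear_r _ k) h1 h2.
by rewrite !tmul_pure !mulrA.
Qed.

Lemma tmul1 : left_id tone tmul.
Proof.
elim/tensor_ind => [a b|k s t h1 h2]; first by rewrite tmul_pure !mul1r.
by rewrite tmul_linear_r h1 h2.
Qed.

Lemma tmulr1 : right_id tone tmul.
Proof.
elim/tensor_ind => [a b|k s t h1 h2]; first by rewrite tmul_pure !mulr1.
by rewrite tmul_linear_l h1 h2.
Qed.

Lemma tmulDl : left_distributive tmul +%R.
Proof.
by move=> s t r; rewrite -[s]scale1r tmul_linear_l !scale1r.
Qed.

Lemma tmulDr : right_distributive tmul +%R.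
Proof.
by move=> r s t; rewrite -[s]scale1r tmul_linear_r !scale1r.
Qed.

Lemma tone_neq0 : tone != 0.
Proof.
have nz (C : falgType K) : exists i, v2r (1 : C) 0 i != 0.
  apply/existsP; apply: contraR (oner_neq0 C) => /existsPn h.
  apply/eqP/v2r_inj/rowP => i; rewrite linear0 mxE.
  by move: (h i); rewrite negbK => /eqP.
have [i hi] := nz A; have [j hj] := nz B.
apply/eqP => /matrixP/(_ i j)/eqP; rewrite !mxE mulf_eq0.
by rewrite (negPf hi) (negPf hj).
Qed.

HB.instance Definition _ := GRing.Zmodule_isNzRing.Build (tensor A B)
  tmulA tmul1 tmulr1 tmulDl tmulDr tone_neq0.

Lemma tscaleAl (k : K) s t : k *: (s * t) = k *: s * t.
Proof.
have t0 : 0 * t = 0 by rewrite mul0r.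
by have := tmul_linear_l t k s 0; rewrite addr0 [tmul 0 t]t0 addr0.
Qed.

HB.instance Definition _ :=
  GRing.Lmodule_isLalgebra.Build K (tensor A B) tscaleAl.

Lemma tscaleAr (k : K) s t : k *: (s * t) = s * (k *: t).
Proof.
have t0 : s * 0 = 0 by rewrite mulr0.
by have := tmul_linear_r s k t 0; rewrite addr0 [tmul s 0]t0 addr0.
Qed.

HB.instance Definition _ :=
  GRing.Lalgebra_isAlgebra.Build K (tensor A B) tscaleAr.

HB.instance Definition _ := Algebra_isFalgebra.Build K (tensor A B).

Lemma tensor1E : 1 = 1 \ox 1 :> tensor A B.
Proof. by []. Qed.

Lemma pure_tensorM a b c d : (a \ox b) * (c \ox d) = (a * c) \ox (b * d).
Proof. exact: tmul_pure. Qed.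

End TensorAlgebra.

(* Algebras in falgType are nonzero, so the zero bialgebra is left out.       *)
Record bialgebra (K : fieldType) := Bialgebra {
  bialg_sort :> falgType K;
  coprod : {lrmorphism bialg_sort -> tensor bialg_sort bialg_sort};
  counit : {lrmorphism bialg_sort -> K^o};
  coprodA : forall h,
    tassoc (tmap coprod id (coprod h)) = tmap id coprod (coprod h);
  counitL : forall h, tlift (fun a b => counit a *: b) (coprod h) = h;
  counitR : forall h, tlift (fun a b => counit b *: a) (coprod h) = h
}.

Section Bialgebras.

Variable K : fieldType.
Implicit Types H A B : bialgebra K.

Definition bialg_isom A B : Prop :=
  exists f : {lrmorphism A -> B},
    [/\ bijective f,
        forall a, coprod B (f a) = tmap f f (coprod A a)
      & forall a, counit B (f a) = counit A a].

Definition is_hopf H : Prop :=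
  exists S : {linear H -> H}, forall h,
    tlift (fun a b => S a * b) (coprod H h) = (counit H h : K)%:A /\
    tlift (fun a b => a * S b) (coprod H h) = (counit H h : K)%:A.

Definition R12 H (R : tensor H H) : tensor (tensor H H) H := R \ox 1.

Definition R13 H (R : tensor H H) : tensor (tensor H H) H :=
  tlift (fun a b => (a \ox 1) \ox b) R.

Definition R23 H (R : tensor H H) : tensor (tensor H H) H :=
  tlift (fun a b => (1 \ox a) \ox b) R.

Definition quasitriangular H (R : tensor H H) : Prop :=
  [/\ R \is a GRing.unit,
      tmap (coprod H) id R = R13 R * R23 R,
      tmap id (coprod H) R = tassoc (R13 R * R12 R)
    & forall h, R * coprod H h = tswap (coprod H h) * R].

(* The H i are a complete irredundant list of the isomorphism classes of      *)
(* bialgebras satisfying P.                                                   *)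
Definition representatives (P : bialgebra K -> Prop) (N : nat)
    (H : 'I_N -> bialgebra K) : Prop :=
  [/\ forall i, P (H i),
      forall i j, bialg_isom (H i) (H j) -> i = j
    & forall B, P B -> exists i, bialg_isom B (H i)].

Definition num_isom_classes (P : bialgebra K -> Prop) (N : nat) : Prop :=
  exists H : 'I_N -> bialgebra K, representatives P H.

Definition hopf_of_dim (n : nat) H : Prop := is_hopf H /\ \dim {:H} = n.

End Bialgebras.

Definition num_nontrivial_qt (K : finFieldType) (N : nat)
    (H : 'I_N -> bialgebra K) : nat :=
  #|[set p : {i : 'I_N & tensor (H i) (H i)} |
      (tagged p != 1 \ox 1) && `[< quasitriangular (tagged p) >]]|.

(* Main.v *)
From HB Require Import structures.
Require Import Defs.
From mathcomp Require Import all_boot all_order all_algebra all_field.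
From mathcomp Require Import boolp ring.

Set Implicit Arguments.
Unset Strict Implicit.
Unset Printing Implicit Defensive.

Import GRing.Theory VectorInternalTheory.

(* A bialgebra of dimension n over F_2 has a basis e_0 = 1, e_1, ..., e_{n-1}
   with the last n-1 vectors spanning the kernel of the counit.  In such a
   basis it is given by (n-1)^3 bits for the product and as many for the
   coproduct, subject to quadratic equations, and isomorphism becomes the
   action of GL_{n-1}(F_2).  The solutions are therefore finite in number:
   the products are enumerated first and reduced to orbit representatives,
   then, for each representative, the compatible coproducts up to its
   automorphisms.  Antipodes and quasitriangular structures are again bit
   vectors solving linear, respectively quadratic, equations.

   The exhaustive searches are recorded as case-split trees whose branches are
   closed by an equation that reduces to 1 = 0; only the checker of these
   trees is proved correct. *)

(** * Structure equations and polynomials over F_2 *)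

(** The count must be carried out by evaluation, while the objects counted live on abstract vector
    spaces over ['F_2]. The bridge is one set of formulas read over three carriers: polynomials,
    where exhaustiveness of a search is checked; bits, where the listed solutions are verified; and
    ['F_2], where sums of the same shape are the axioms. Evaluating polynomials at bits and
    including bits in ['F_2] both respect the operations, so equations travel along the chain. The
    normal form of the basis rests on the splitting of H into K 1 and the kernel of the counit,
    valid because the counit maps 1 to 1. Completeness and irredundancy of a list are separate
    claims. The first needs explicit changes of basis, which the leaf labels supply. The second
    quantifies over all changes of basis, so the list of matrices must itself be certified
    exhaustive; this is why GL_{n-1} is also obtained as the solution set of a polynomial system.
    The number of quasitriangular structures is a function of the structure constants alone, hence
    the same for every choice of representatives. *)

(* The equations are written over arbitrary operations, so that they can be
   evaluated both on bits and on polynomials in unknown bits.  Every equation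
   is encoded as the sum of its two sides, which is meant to vanish in
   characteristic 2.  The conventions are e_i e_j = \sum_k M i j k e_k and
   Delta e_i = \sum_jk D i j k e_j (x) e_k. *)
Record ops (T : Type) := Ops {
  o0 : T; o1 : T; oadd : T -> T -> T; omul : T -> T -> T }.

Definition bops := Ops false true addb andb.

Section Formulas.
Variables (T : Type) (o : ops T) (n : nat).
Local Notation "x + y" := (oadd o x y).
Local Notation "x * y" := (omul o x y).

Definition osum (F : nat -> T) : T := foldr (fun i s => F i + s) (o0 o) (iota 0 n).
Definition dlt (i j : nat) : T := if eqn i j then o1 o else o0 o.

Definition assoc_eqn (M : nat -> nat -> nat -> T) i j k l : T :=
  osum (fun x => M i j x * M x k l) + osum (fun x => M j k x * M i x l).
Definition coassoc_eqn (D : nat -> nat -> nat -> T) i j k l : T :=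
  osum (fun x => D i x l * D x j k) + osum (fun x => D i j x * D x k l).
Definition compat_eqn (M D : nat -> nat -> nat -> T) i j k l : T :=
  osum (fun x => M i j x * D x k l) +
  osum (fun a => osum (fun b => D i a b *
    osum (fun c => M a c k * osum (fun e => M b e l * D j c e)))).
Definition inv_eqn (g h : nat -> nat -> T) i j : T :=
  osum (fun x => g i x * h x j) + dlt i j.
(* Constants in the basis e'_i = \sum_a g i a e_a, where h is the inverse of g. *)
Definition chgM (g h : nat -> nat -> T) (M : nat -> nat -> nat -> T) i j k : T :=
  osum (fun a => g i a * osum (fun b => g j b * osum (fun c => h c k * M a b c))).
Definition chgD (g h : nat -> nat -> T) (D : nat -> nat -> nat -> T) i j k : T :=
  osum (fun a => g i a * osum (fun b => h b j * osum (fun c => h c k * D a b c))).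
(** Convolution of the antipode with the identity; the added term is the coordinate of eps(e_i) 1,
    as eps(e_i) is 1 for i = 0 and 0 otherwise. *)
Definition hopfL (M D : nat -> nat -> nat -> T) (S : nat -> nat -> T) i l : T :=
  osum (fun a => osum (fun b => D i a b * osum (fun c => M c b l * S a c)))
    + dlt i 0 * dlt l 0.
Definition hopfR (M D : nat -> nat -> nat -> T) (S : nat -> nat -> T) i l : T :=
  osum (fun a => osum (fun b => D i a b * osum (fun c => M a c l * S b c)))
    + dlt i 0 * dlt l 0.
Definition tmulc (M : nat -> nat -> nat -> T) (r s : nat -> nat -> T) k l : T :=
  osum (fun a => osum (fun c => M a c k *
    osum (fun b => osum (fun e => M b e l * (r a b * s c e))))).
Definition tinv_eqn (M : nat -> nat -> nat -> T) (r s : nat -> nat -> T) k l : T :=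
  tmulc M r s k l + dlt k 0 * dlt l 0.
(** Coefficient of e_i (x) e_j (x) e_k in (Delta (x) id) R = R_13 R_23. Likewise [hex2] encodes (id
    (x) Delta) R = R_13 R_12, and [qcomm] encodes R Delta h = Delta^cop h R. *)
Definition hex1 (M D : nat -> nat -> nat -> T) (r : nat -> nat -> T) i j k : T :=
  osum (fun a => D a i j * r a k) +
  osum (fun a => osum (fun b => M a b k * (r i a * r j b))).
Definition hex2 (M D : nat -> nat -> nat -> T) (r : nat -> nat -> T) i j k : T :=
  osum (fun a => D a j k * r i a) +
  osum (fun a => osum (fun b => M a b i * (r a k * r b j))).
Definition qcomm (M D : nat -> nat -> nat -> T) (r : nat -> nat -> T) h k l : T :=
  tmulc M r (D h) k l + tmulc M (fun a b => D h b a) r k l.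

Definition nth3 (t : seq (seq (seq T))) i j k :=
  nth (o0 o) (nth [::] (nth [::] t i) j) k.
Definition nth2 (t : seq (seq T)) i j := nth (o0 o) (nth [::] t i) j.
(* In the bases considered, e_0 = 1 and the other vectors span the kernel of
   the counit; a table only holds the entries with positive indices, shifted
   by one. *)
Definition cM t i j k : T :=
  match i, j, k with
  | 0, _, _ => dlt j k
  | _, 0, _ => dlt i k
  | _, _, 0 => o0 o
  | i'.+1, j'.+1, k'.+1 => nth3 t i' j' k'
  end.
(** The counit axioms force the entries with j = 0 or k = 0; the remaining entries with i = 0 vanish
    because Delta 1 = 1 (x) 1. *)
Definition cD t i j k : T :=
  match j, k, i with
  | 0, _, _ => dlt i k
  | _, 0, _ => dlt i j
  | _, _, 0 => o0 o
  | j'.+1, k'.+1, i'.+1 => nth3 t i' j' k'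
  end.
(** An isomorphism fixes 1 and preserves the kernel of the counit, so only the lower right block of
    its matrix is free. *)
Definition cG t i j : T :=
  match i, j with 0, _ => dlt 0 j | _, 0 => o0 o | i'.+1, j'.+1 => nth2 t i' j' end.

(** Flattened, so that a single position identifies an equation of a system. *)
Definition eqs4 (F : nat -> nat -> nat -> nat -> T) (s1 s2 s3 s4 : seq nat) :
  seq T :=
  flatten [seq flatten
    [seq flatten [seq [seq F i j k l | l <- s4] | k <- s3] | j <- s2] | i <- s1].
Definition eqs3 (F : nat -> nat -> nat -> T) (s1 s2 s3 : seq nat) : seq T :=
  flatten [seq flatten [seq [seq F i j k | k <- s3] | j <- s2] | i <- s1].
Definition eqs2 (F : nat -> nat -> T) (s1 s2 : seq nat) : seq T :=
  flatten [seq [seq F i j | j <- s2] | i <- s1].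

Definition mk3 m (f : nat -> nat -> nat -> T) :=
  [seq [seq [seq f i j k | k <- iota 0 m] | j <- iota 0 m] | i <- iota 0 m].
Definition mk2 m (f : nat -> nat -> T) :=
  [seq [seq f i j | j <- iota 0 m] | i <- iota 0 m].
End Formulas.

(** * Polynomials in unknown bits *)

Definition mono := seq nat.
Definition pol := seq mono.

(** Written with [if] instead of [&&]: under call by value the comparison then stops at the first
    difference. *)
Fixpoint eqmono (a b : mono) : bool :=
  match a, b with
  | [::], [::] => true
  | x :: a', y :: b' => if eqn x y then eqmono a' b' else false
  | _, _ => false
  end.

(** A polynomial is the set of its monomials; in characteristic 2 adding a monomial already present
    removes it. *)
Fixpoint toggle (m : mono) (p : pol) : pol :=
  match p with
  | [::] => [:: m]
  | m' :: p' => if eqmono m m' then p' else m' :: toggle m p'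
  end.

(** A repeated variable is kept once, since x^2 = x on bits; sorting makes equal monomials equal
    lists. *)
Fixpoint mins (v : nat) (m : mono) : mono :=
  match m with
  | [::] => [:: v]
  | u :: m' => if eqn v u then m else if v < u then v :: m else u :: mins v m'
  end.

Definition mmul (a b : mono) : mono := foldr mins b a.
Definition padd (p q : pol) : pol := foldr toggle q p.
Definition pmul (p q : pol) : pol :=
  foldr (fun a s => foldr (fun b s => toggle (mmul a b) s) s q) [::] p.
Definition pops : ops pol := Ops [::] [:: [::]] padd pmul.
Definition pvar (v : nat) : pol := [:: [:: v]].
Definition pcst (b : bool) : pol := if b then [:: [::]] else [::].

Definition is_one (p : pol) : bool := if p is [:: [::]] then true else false.

(** * Case-split certificates and the solver *)

Definition asg := seq (option bool).

(** The result [None] stands for a monomial killed by a variable set to 0. *)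
Fixpoint msub (a : asg) (m : mono) : option mono :=
  match m with
  | [::] => Some [::]
  | v :: m' => match nth None a v with
    | Some false => None
    | Some true => msub a m'
    | None => if msub a m' is Some m'' then Some (v :: m'') else None
    end
  end.

Definition psub (a : asg) (p : pol) : pol :=
  foldr (fun m q => if msub a m is Some m' then toggle m' q else q) [::] p.

Definition start N : asg := nseq N None.

(* Certificates for the solution set of a list of polynomials: [Clash k] says
   that the [k]-th polynomial takes the value 1 under the current partial
   assignment, and the label of a [Leaf] is a hint for the property checked
   of the solution reached. *)
Inductive tree := Leaf of nat | Clash of nat | Split of nat & tree & tree.

Section Check.
Variables (good : nat -> seq bool -> bool) (ps : seq pol).

Fixpoint check (a : asg) (t : tree) : bool :=
  match t with
  | Leaf x => if all isSome a then good x (map (odflt false) a) else false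
  | Clash k => is_one (psub a (nth [::] ps k))
  | Split v t0 t1 =>
      if check (set_nth None a v (Some false)) t0
      then check (set_nth None a v (Some true)) t1 else false
  end.

End Check.

Fixpoint find_clash (qs : seq (nat * pol)) : option nat :=
  match qs with
  | [::] => None
  | (k, p) :: qs' => if is_one p then Some k else find_clash qs'
  end.

(** A polynomial v or 1 + v determines v: splitting on such a variable closes one of the two
    branches at once. *)
Fixpoint find_unit (qs : seq (nat * pol)) : option nat :=
  match qs with
  | [::] => None
  | (_, [:: [:: v]]) :: _
  | (_, [:: [::]; [:: v]]) :: _
  | (_, [:: [:: v]; [::]]) :: _ => Some v
  | _ :: qs' => find_unit qs'
  end.

Definition msub1 v (b : bool) (m : mono) : option mono :=
  if has (eqn v) m then
    if b then Some (filter (fun u => ~~ eqn v u) m) else None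
  else Some m.

Definition psub1 v b (p : pol) : pol :=
  if has (has (eqn v)) p then
    foldr (fun m q => if msub1 v b m is Some m' then toggle m' q else q) [::] p
  else p.

(** Polynomials that became zero are dropped; the others keep their original position, which a
    [Clash] has to quote. *)
Definition sub1 v b (qs : seq (nat * pol)) : seq (nat * pol) :=
  pmap (fun kp : nat * pol =>
    let p := psub1 v b kp.2 in if p is [::] then None else Some (kp.1, p)) qs.

(** When every variable is set, [find] returns [size a], the test [v < size a] fails and a leaf
    results. *)
Fixpoint search fuel (a : asg) (qs : seq (nat * pol)) : tree :=
  if fuel is f.+1 then
    if find_clash qs is Some k then Clash k else
    let v := odflt (find (fun x => ~~ isSome x) a) (find_unit qs) in
    if v < size a then
      Split v (search f (set_nth None a v (Some false)) (sub1 v false qs))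
              (search f (set_nth None a v (Some true)) (sub1 v true qs))
    else Leaf 0
  else Leaf 0.

(* Nothing is proved about this solver: its results are validated by [check]. *)
Definition solve N (ps : seq pol) : tree :=
  search N.+1 (start N)
    (filter (fun kp => kp.2 != [::]) (zip (iota 0 (size ps)) ps)).

Fixpoint leaves (a : asg) (t : tree) : seq (seq bool) :=
  match t with
  | Leaf _ => [:: map (odflt false) a]
  | Clash _ => [::]
  | Split v t0 t1 => leaves (set_nth None a v (Some false)) t0 ++
                     leaves (set_nth None a v (Some true)) t1
  end.

Fixpoint relabel (lab : seq bool -> nat) (a : asg) (t : tree) : tree :=
  match t with
  | Leaf _ => Leaf (lab (map (odflt false) a))
  | Clash k => Clash k
  | Split v t0 t1 => Split v (relabel lab (set_nth None a v (Some false)) t0)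
                             (relabel lab (set_nth None a v (Some true)) t1)
  end.

(** * The systems of equations and the action of GL_m *)

Definition tab3 := seq (seq (seq bool)).
Definition tab2 := seq (seq bool).
Definition zeros (s : seq bool) := all negb s.

Section Systems.
Variable m : nat.
Let n := m.+1.
Let r := iota 0 n.
Let r1 := iota 1 m.

(** The index 0 is left out wherever the shape of the tables already forces the equation: in the
    arguments of the product, and for the coproduct of 1. *)
Definition M_eqs T (o : ops T) M := eqs4 (assoc_eqn o n M) r1 r1 r1 r.
Definition D_eqs T (o : ops T) M D :=
  eqs4 (compat_eqn o n M D) r1 r1 r r ++ eqs4 (coassoc_eqn o n D) r1 r r r.
(** Taking the inverse matrix as a second block of unknowns expresses invertibility by quadratic
    equations. *)
Definition G_eqs T (o : ops T) g h :=
  eqs2 (inv_eqn o n g h) r r ++ eqs2 (inv_eqn o n h g) r r.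
Definition S_eqs T (o : ops T) M D s :=
  eqs2 (hopfL o n M D s) r r ++ eqs2 (hopfR o n M D s) r r.
(* X is the inverse of R. *)
Definition R_eqs T (o : ops T) M D R X :=
  eqs2 (tinv_eqn o n M R X) r r ++ eqs2 (tinv_eqn o n M X R) r r ++
  eqs3 (hex1 o n M D R) r r r ++ eqs3 (hex2 o n M D R) r r r ++
  eqs3 (qcomm o n M D R) r r r.

Definition code3 i j k := (i * m + j) * m + k.
Definition w3 (w : seq bool) : tab3 :=
  mk3 m (fun i j k => nth false w (code3 i j k)).
Definition v3 : seq (seq (seq pol)) := mk3 m (fun i j k => pvar (code3 i j k)).
Definition w2 off (w : seq bool) : tab2 :=
  mk2 m (fun i j => nth false w (off + (i * m + j))).
Definition v2 off : seq (seq pol) :=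
  mk2 m (fun i j => pvar (off + (i * m + j))).

Definition pM (t : tab3) i j k := pcst (cM bops t i j k).
Definition pD (t : tab3) i j k := pcst (cD bops t i j k).

Definition M_sys := M_eqs pops (cM pops v3).
Definition D_sys (t : tab3) := D_eqs pops (pM t) (cD pops v3).
Definition G_sys := G_eqs pops (cG pops (v2 0)) (cG pops (v2 (m * m))).

Definition newM (gh : tab2 * tab2) (t : tab3) : tab3 :=
  mk3 m (fun i j k =>
    chgM bops n (cG bops gh.1) (cG bops gh.2) (cM bops t) i.+1 j.+1 k.+1).
Definition newD (gh : tab2 * tab2) (t : tab3) : tab3 :=
  mk3 m (fun i j k =>
    chgD bops n (cG bops gh.1) (cG bops gh.2) (cD bops t) i.+1 j.+1 k.+1).

End Systems.

Definition S_sys m (x : tab3 * tab3) :=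
  S_eqs m pops (pM x.1) (pD x.2) (nth2 pops (v2 m.+1 0)).
Definition R_sys m (x : tab3 * tab3) :=
  R_eqs m pops (pM x.1) (pD x.2)
    (nth2 pops (v2 m.+1 0)) (nth2 pops (v2 m.+1 (m.+1 * m.+1))).

Definition swap (gh : tab2 * tab2) := (gh.2, gh.1).

Fixpoint eqw (s t : seq bool) : bool :=
  match s, t with
  | [::], [::] => true
  | x :: s', y :: t' => if eqb x y then eqw s' t' else false
  | _, _ => false
  end.

Fixpoint lookup (y : seq bool) (s : seq (seq bool * nat)) : option nat :=
  if s is (x, k) :: s' then if eqw x y then Some k else lookup y s' else None.

Section Orbits.
Variables (m : nat) (tr : tab2 * tab2 -> tab3 -> tab3).

(** Greedy: the first remaining word becomes a representative [x] and its orbit is discarded. The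
    label found for a word y is that of a g with y = g x, so it is the inverse of g that brings y
    back. Insufficient fuel could only make the final check fail. *)
Fixpoint orbits fuel (gl : seq (nat * (tab2 * tab2))) (ws : seq (seq bool)) :
    seq (tab3 * seq (seq bool * nat)) :=
  match fuel, ws with
  | f.+1, w :: ws' =>
    let x := w3 m w in
    let o := [seq (flatten (flatten (tr kg.2 x)), kg.1) | kg <- gl] in
    (x, o) :: orbits f gl (filter (fun y => ~~ isSome (lookup y o)) ws')
  | _, _ => [::]
  end.

End Orbits.

Definition orbit_label (os : seq (tab3 * seq (seq bool * nat))) w : nat :=
  odflt 0 (lookup w (flatten (map snd os))).

(** * Certificates for the classification of bialgebras *)

Record mult_group := MultGroup {
  mult_of : tab3; comults_of : seq tab3; comult_tree : tree }.
HB.instance Definition _ := gen_eqMixin mult_group.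

(* [gl_elts] lists the pairs (g, g^-1) of GL_m, and the leaves of [mult_tree]
   and [comult_tree] are labelled by the position of a pair whose inverse
   carries the solution to its representative. *)
Record cert := Cert {
  gl_elts : seq (tab2 * tab2); gl_tree : tree;
  mults : seq tab3; mult_tree : tree; mult_groups : seq mult_group }.

Section Certificates.
Variable m : nat.

Definition G_of_word w : tab2 * tab2 := (w2 m 0 w, w2 m (m * m) w).

Definition find_cert : cert :=
  let Gt := solve (2 * (m * m)) (G_sys m) in
  let gl := map G_of_word (leaves (start (2 * (m * m))) Gt) in
  let igl := zip (iota 0 (size gl)) gl in
  let N := m * m * m in
  let Mt := solve N (M_sys m) in
  let os := orbits m (newM m) N.*2 igl (leaves (start N) Mt) in
  let grp M :=
    let aut := filter (fun kg => newM m kg.2 M == M) igl in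
    let Dt := solve N (D_sys m M) in
    let os := orbits m (newD m) N.*2 aut (leaves (start N) Dt) in
    MultGroup M (map fst os) (relabel (orbit_label os) (start N) Dt) in
  let Ms := map fst os in
  Cert gl Gt Ms (relabel (orbit_label os) (start N) Mt) (map grp Ms).

Variable c : cert.

Definition gl_nth k := nth ([::], [::]) (gl_elts c) k.

Definition reps : seq (tab3 * tab3) :=
  flatten [seq [seq (mult_of x, d) | d <- comults_of x] | x <- mult_groups c].

(** The first half makes every listed pair a legitimate change of basis, as completeness requires;
    the second says that no invertible matrix is missing, as irredundancy requires. *)
Definition check_gl :=
  all (fun gh => zeros (G_eqs m bops (cG bops gh.1) (cG bops gh.2))) (gl_elts c) &&
  check (fun _ w => G_of_word w \in gl_elts c)
    (G_sys m) (start (2 * (m * m))) (gl_tree c).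

(** The bound on [k] keeps [gl_nth] away from its default value. *)
Definition check_mults :=
  check (fun k w => if k < size (gl_elts c) then
      newM m (swap (gl_nth k)) (w3 m w) \in mults c else false)
    (M_sys m) (start (m * m * m)) (mult_tree c).

(** Once the product is normalised, a coproduct may be moved only by automorphisms of that algebra;
    the test on [newM] ensures this. *)
Definition check_comults (x : mult_group) :=
  check (fun k w => if k < size (gl_elts c) then
      let gh := swap (gl_nth k) in
      if newM m gh (mult_of x) == mult_of x then
        newD m gh (w3 m w) \in comults_of x else false else false)
    (D_sys m (mult_of x)) (start (m * m * m)) (comult_tree x).

Definition check_groups :=
  (map mult_of (mult_groups c) == mults c) && all check_comults (mult_groups c).

(** An isomorphism between two listed bialgebras is given by a listed matrix, so it suffices that no
    matrix carries one entry to a different one. Products without a compatible coproduct contribute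
    nothing to [reps] and are skipped. *)
Definition check_separated :=
  all (fun gh => all (fun x =>
    if comults_of x is [::] then true else
    let Mx := newM m gh (mult_of x) in
    all (fun y =>
      if comults_of y is [::] then true else
      if Mx == mult_of y then
        (mult_of x == mult_of y) &&
        all (fun d => let d' := newD m gh d in
          all (fun e => if d' == e then d == e else true) (comults_of y))
          (comults_of x)
      else true) (mult_groups c)) (mult_groups c)) (gl_elts c).

Definition check_axioms :=
  all (fun x => if comults_of x is [::] then true else
    zeros (M_eqs m bops (cM bops (mult_of x))) &&
    all (fun d => zeros (D_eqs m bops (cM bops (mult_of x)) (cD bops d)))
      (comults_of x)) (mult_groups c).

(** Structure constants see only the entries with indices below [m]. Tables of exactly this shape
    are determined by those entries, so equal constants give equal tables. *)
Definition is_mk3 (t : tab3) := t == mk3 m (nth3 bops t).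

Definition check_tables :=
  all (fun x => is_mk3 (mult_of x) && all is_mk3 (comults_of x)) (mult_groups c).

Definition check_cert :=
  [&& check_gl, check_mults, check_groups, check_separated, check_axioms,
      check_tables & uniq reps].

End Certificates.

(* [Antipode s ws t]: s is the antipode, and the words in ws are the pairs
   (R, R^-1) with R quasitriangular. *)
Inductive hopf_cert :=
  Antipode of tab2 & seq (seq bool) & tree | NoAntipode of tree.
HB.instance Definition _ := gen_eqMixin hopf_cert.

Definition has_antipode (hc : hopf_cert) : bool :=
  if hc is Antipode _ _ _ then true else false.

(** * Certificates for antipodes and quasitriangular structures *)

Section HopfCertificates.
Variable m : nat.
Let n := m.+1.

Definition find_hopf_cert (x : tab3 * tab3) : hopf_cert :=
  let t := solve (n * n) (S_sys m x) in
  if leaves (start (n * n)) t is w :: _ then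
    let t' := solve (2 * (n * n)) (R_sys m x) in
    Antipode (w2 n 0 w) (leaves (start (2 * (n * n))) t') t'
  else NoAntipode t.

(** With a constantly false leaf test, a tree is accepted only if all its branches clash, so no
    antipode exists. In the other case distinctness and membership are tested on the first halves of
    the words, because what is counted is R and not the pair (R, R^-1). *)
Definition check_hopf (x : tab3 * tab3) (hc : hopf_cert) : bool :=
  match hc with
  | NoAntipode t => check (fun _ _ => false) (S_sys m x) (start (n * n)) t
  | Antipode s ws t => let cm := cM bops x.1 in let cd := cD bops x.2 in
    [&& zeros (S_eqs m bops cm cd (nth2 bops s)),
        all (fun w => zeros (R_eqs m bops cm cd
          (nth2 bops (w2 n 0 w)) (nth2 bops (w2 n (n * n) w)))) ws,
        uniq (map (w2 n 0) ws)
      & check (fun _ w => w2 n 0 w \in map (w2 n 0) ws)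
          (R_sys m x) (start (2 * (n * n))) t]
  end.

Definition unit_tab : tab2 := mk2 n (fun i j => dlt bops i 0 && dlt bops j 0).

Definition num_R (hc : hopf_cert) : nat :=
  if hc is Antipode _ ws _ then count (fun w => w2 n 0 w != unit_tab) ws else 0.

Definition find_hopf_certs (rs : seq (tab3 * tab3)) :=
  [seq (x, find_hopf_cert x) | x <- rs].

Definition check_hopfs rs (hl : seq (tab3 * tab3 * hopf_cert)) :=
  (map fst hl == rs) && all (fun xh => check_hopf xh.1 xh.2) hl.

Definition hopf_reps (hl : seq (tab3 * tab3 * hopf_cert)) :=
  map fst (filter (has_antipode \o snd) hl).

End HopfCertificates.

(** * Correctness of polynomial arithmetic and of the tree checker *)

Section Evaluation.
Variable e : nat -> bool.

Definition meval (m : mono) : bool := all e m.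
Definition peval (p : pol) : bool := foldr (fun m b => meval m (+) b) false p.

Lemma eqmonoP a b : eqmono a b -> a = b.
Proof. by elim: a b => [|x a IH] [|y b] //=; case: eqnP => // -> /IH ->. Qed.

Lemma peval_toggle m p : peval (toggle m p) = meval m (+) peval p.
Proof.
elim: p => [|m' p IH] //=; case: ifP => [/eqmonoP <-|_] /=; first by rewrite addKb.
by rewrite IH addbCA.
Qed.

Lemma peval_add p q : peval (padd p q) = peval p (+) peval q.
Proof. by rewrite /padd; elim: p => //= m p IH; rewrite peval_toggle IH addbA. Qed.

Lemma meval_mins v m : meval (mins v m) = e v && meval m.
Proof.
elim: m => //= u m IH; case: eqnP => [->|_] /=; first by rewrite andbA andbb.
by case: ifP => //= _; rewrite IH andbCA.
Qed.

Lemma meval_mul a b : meval (mmul a b) = meval a && meval b.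
Proof. by rewrite /mmul; elim: a => //= v a IH; rewrite meval_mins IH andbA. Qed.

Lemma peval_mul p q : peval (pmul p q) = peval p && peval q.
Proof.
rewrite /pmul; elim: p => //= a p IH.
have inner s : peval (foldr (fun b s => toggle (mmul a b) s) s q) =
  (meval a && peval q) (+) peval s.
  elim: q {IH} => [|b q IH] /=; first by rewrite andbF.
  by rewrite peval_toggle meval_mul IH andb_addr addbA.
by rewrite inner IH andb_addl.
Qed.

Lemma peval_var v : peval (pvar v) = e v.
Proof. by rewrite /= andbT addbF. Qed.

Lemma peval_cst b : peval (pcst b) = b.
Proof. by case: b. Qed.

Definition refines (a : asg) := forall v b, nth None a v = Some b -> e v = b.

Lemma peval_sub a p : refines a -> peval (psub a p) = peval p.
Proof.
move=> ra; have ms m : meval m = if msub a m is Some m' then meval m' else false.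
  elim: m => //= v m ->; case av: (nth None a v) => [[]|].
  - by rewrite (ra _ _ av).
  - by rewrite (ra _ _ av).
  by case: (msub a m) => //=; rewrite andbF.
rewrite /psub; elim: p => //= m p <-; rewrite ms.
by case: (msub a m) => [m'|] //=; rewrite peval_toggle.
Qed.

Lemma refines_set a v : refines a -> refines (set_nth None a v (Some (e v))).
Proof.
by move=> ra u b; rewrite nth_set_nth /=; case: eqP => [->[<-]|_ /ra].
Qed.

(** Follow the tree along the values of [e]. A clash would exhibit a polynomial with value 1 at the
    common zero [e], so the descent ends in a leaf, whose complete assignment agrees with [e]. *)
Lemma check_refines good ps t a : all (fun p => ~~ peval p) ps -> refines a ->
  check good ps a t -> exists x w, good x w /\ forall v, v < size a ->
    nth false w v = e v.
Proof.
move=> hps; elim: t a => [x|k|v t0 IH0 t1 IH1] a ra /=.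
- case: ifP => // aS gx; exists x, (map (odflt false) a); split=> // v va.
  rewrite (nth_map None) //; have /allP/(_ _ (mem_nth None va)) := aS.
  by case av: (nth None a v) => [b|] //= _; rewrite (ra _ _ av).
- have := peval_sub (nth [::] ps k) ra.
  case: (psub _ _) => [|[|? ?] [|? ?]] //= pk _.
  (* Beyond the end of the list [nth] returns the zero polynomial, whose value cannot be 1. *)
  have [kp|kp] := ltnP k (size ps); last by rewrite nth_default in pk.
  by have /allP/(_ _ (mem_nth [::] kp)) := hps; rewrite -pk.
case: ifP => // c0 c1.
have [x [w [gx hw]]] : exists x w, good x w /\
    forall u, u < size (set_nth None a v (Some (e v))) -> nth false w u = e u.
  by case ev: (e v); [apply: IH1|apply: IH0] => //; rewrite -ev; apply: refines_set.
exists x, w; split=> // u ua; apply: hw.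
by rewrite size_set_nth (leq_trans ua) ?leq_maxr.
Qed.

Lemma check_sound good ps t N : check good ps (start N) t ->
  all (fun p => ~~ peval p) ps ->
  exists x w, good x w /\ forall v, v < N -> nth false w v = e v.
Proof.
move=> ct hps; have rs : refines (start N).
  by move=> v b; rewrite /start nth_nseq; case: ifP.
by have [x [w [gx hw]]] := check_refines hps rs ct; exists x, w; split=> // v vN;
   apply: hw; rewrite size_nseq.
Qed.
End Evaluation.

(** * Transport of the formulas along maps respecting the operations *)

Section Morphism.
Variables (T T' : Type) (o : ops T) (o' : ops T') (f : T -> T') (n : nat).
Hypotheses (f0 : f (o0 o) = o0 o') (f1 : f (o1 o) = o1 o').
Hypotheses (fD : forall x y, f (oadd o x y) = oadd o' (f x) (f y)).
Hypotheses (fM : forall x y, f (omul o x y) = omul o' (f x) (f y)).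

Lemma osum_morph F : f (osum o n F) = osum o' n (f \o F).
Proof. by rewrite /osum; elim: (iota 0 n) => //= i s IH; rewrite fD IH. Qed.

Lemma dlt_morph i j : f (dlt o i j) = dlt o' i j.
Proof. by rewrite /dlt; case: ifP. Qed.

Lemma osum_ext F G : F =1 G -> osum o' n F = osum o' n G.
Proof. by move=> FG; rewrite /osum; elim: (iota 0 n) => //= i s ->; rewrite FG. Qed.

Ltac morph := repeat first
  [ done | rewrite fD; congr (oadd _ _ _) | rewrite fM; congr (omul _ _ _)
  | rewrite osum_morph; apply: osum_ext => ? /= | rewrite dlt_morph ].

Let f2 (g : nat -> nat -> T) i j := f (g i j).
Let f3 (g : nat -> nat -> nat -> T) i j k := f (g i j k).

Lemma assoc_morph M i j k l : f (assoc_eqn o n M i j k l) =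
  assoc_eqn o' n (f3 M) i j k l.
Proof. by rewrite /assoc_eqn; morph. Qed.
Lemma coassoc_morph D i j k l : f (coassoc_eqn o n D i j k l) =
  coassoc_eqn o' n (f3 D) i j k l.
Proof. by rewrite /coassoc_eqn; morph. Qed.
Lemma compat_morph M D i j k l : f (compat_eqn o n M D i j k l) =
  compat_eqn o' n (f3 M) (f3 D) i j k l.
Proof. by rewrite /compat_eqn; morph. Qed.
Lemma inv_morph g h i j : f (inv_eqn o n g h i j) = inv_eqn o' n (f2 g) (f2 h) i j.
Proof. by rewrite /inv_eqn; morph. Qed.
Lemma hopfL_morph M D s i l : f (hopfL o n M D s i l) =
  hopfL o' n (f3 M) (f3 D) (f2 s) i l.
Proof. by rewrite /hopfL; morph. Qed.
Lemma hopfR_morph M D s i l : f (hopfR o n M D s i l) =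
  hopfR o' n (f3 M) (f3 D) (f2 s) i l.
Proof. by rewrite /hopfR; morph. Qed.
Lemma tinv_morph M r s k l : f (tinv_eqn o n M r s k l) =
  tinv_eqn o' n (f3 M) (f2 r) (f2 s) k l.
Proof. by rewrite /tinv_eqn /tmulc; morph. Qed.
Lemma hex1_morph M D r i j k : f (hex1 o n M D r i j k) =
  hex1 o' n (f3 M) (f3 D) (f2 r) i j k.
Proof. by rewrite /hex1; morph. Qed.
Lemma hex2_morph M D r i j k : f (hex2 o n M D r i j k) =
  hex2 o' n (f3 M) (f3 D) (f2 r) i j k.
Proof. by rewrite /hex2; morph. Qed.
Lemma qcomm_morph M D r i j k : f (qcomm o n M D r i j k) =
  qcomm o' n (f3 M) (f3 D) (f2 r) i j k.
Proof. by rewrite /qcomm /tmulc; morph. Qed.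

Lemma map_eqs4 F F' s1 s2 s3 s4 : (forall i j k l, f (F i j k l) = F' i j k l) ->
  map f (eqs4 F s1 s2 s3 s4) = eqs4 F' s1 s2 s3 s4.
Proof.
move=> FF; rewrite /eqs4 !map_flatten -!map_comp; congr flatten;
  apply: eq_map => i /=.
rewrite !map_flatten -!map_comp; congr flatten; apply: eq_map => j /=.
rewrite !map_flatten -!map_comp; congr flatten; apply: eq_map => k /=.
by rewrite -map_comp; apply: eq_map => l /=.
Qed.

Lemma map_eqs3 F F' s1 s2 s3 : (forall i j k, f (F i j k) = F' i j k) ->
  map f (eqs3 F s1 s2 s3) = eqs3 F' s1 s2 s3.
Proof.
move=> FF; rewrite /eqs3 !map_flatten -!map_comp; congr flatten;
  apply: eq_map => i /=.
rewrite !map_flatten -!map_comp; congr flatten; apply: eq_map => j /=.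
by rewrite -map_comp; apply: eq_map => k /=.
Qed.

Lemma map_eqs2 F F' s1 s2 : (forall i j, f (F i j) = F' i j) ->
  map f (eqs2 F s1 s2) = eqs2 F' s1 s2.
Proof.
move=> FF; rewrite /eqs2 !map_flatten -!map_comp; congr flatten;
  apply: eq_map => i /=.
by rewrite -map_comp; apply: eq_map => j /=.
Qed.

End Morphism.

Section SystemMorphism.
Variables (T T' : Type) (o : ops T) (o' : ops T') (f : T -> T') (m : nat).
Hypotheses (f0 : f (o0 o) = o0 o') (f1 : f (o1 o) = o1 o').
Hypotheses (fD : forall x y, f (oadd o x y) = oadd o' (f x) (f y)).
Hypotheses (fM : forall x y, f (omul o x y) = omul o' (f x) (f y)).
Let f2 (g : nat -> nat -> T) i j := f (g i j).
Let f3 (g : nat -> nat -> nat -> T) i j k := f (g i j k).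

Lemma M_eqs_morph M : map f (M_eqs m o M) = M_eqs m o' (f3 M).
Proof. by apply: map_eqs4 => *; apply: assoc_morph. Qed.

Lemma D_eqs_morph M D : map f (D_eqs m o M D) = D_eqs m o' (f3 M) (f3 D).
Proof.
by rewrite /D_eqs map_cat; congr cat; apply: map_eqs4 => *;
  [apply: compat_morph|apply: coassoc_morph].
Qed.

Lemma G_eqs_morph g h : map f (G_eqs m o g h) = G_eqs m o' (f2 g) (f2 h).
Proof.
by rewrite /G_eqs map_cat; congr cat; apply: map_eqs2 => *; apply: inv_morph.
Qed.

Lemma S_eqs_morph M D s : map f (S_eqs m o M D s) = S_eqs m o' (f3 M) (f3 D) (f2 s).
Proof.
by rewrite /S_eqs map_cat; congr cat; apply: map_eqs2 => *;
  [apply: hopfL_morph|apply: hopfR_morph].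
Qed.

Lemma R_eqs_morph M D r x : map f (R_eqs m o M D r x) =
  R_eqs m o' (f3 M) (f3 D) (f2 r) (f2 x).
Proof.
rewrite /R_eqs map_cat; apply: (f_equal2 cat); first by apply: map_eqs2 => *;
  apply: tinv_morph.
rewrite map_cat; apply: (f_equal2 cat); first by apply: map_eqs2 => *;
  apply: tinv_morph.
rewrite map_cat; apply: (f_equal2 cat); first by apply: map_eqs3 => *;
  apply: hex1_morph.
rewrite map_cat; apply: (f_equal2 cat); first by apply: map_eqs3 => *;
  apply: hex2_morph.
by apply: map_eqs3 => *; apply: qcomm_morph.
Qed.

Lemma nth3_morph t i j k :
  f (nth3 o t i j k) = nth3 o' (map (map (map f)) t) i j k.
Proof.
have nm (A B : Type) (g : seq A -> seq B) s x : g [::] = [::] -> g (nth [::] s x) =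
  nth [::] (map g s) x.
  by move=> g0; elim: s x => [|a s IH] [|x] //=.
rewrite /nth3 -!nm // -f0.
by elim: (nth [::] (nth [::] t i) j) k => [|a s IH] [|k] //=.
Qed.

Lemma nth2_morph t i j : f (nth2 o t i j) = nth2 o' (map (map f) t) i j.
Proof.
have nm (A B : Type) (g : seq A -> seq B) s x : g [::] = [::] -> g (nth [::] s x) =
  nth [::] (map g s) x.
  by move=> g0; elim: s x => [|a s IH] [|x] //=.
rewrite /nth2 -!nm // -f0.
by elim: (nth [::] t i) j => [|a s IH] [|j] //=.
Qed.

Lemma cM_morph t i j k : f (cM o t i j k) = cM o' (map (map (map f)) t) i j k.
Proof.
by case: i j k => [|i] [|j] [|k] /=; rewrite ?(dlt_morph f0 f1) ?nth3_morph.
Qed.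

Lemma cD_morph t i j k : f (cD o t i j k) = cD o' (map (map (map f)) t) i j k.
Proof.
by case: i j k => [|i] [|j] [|k] /=; rewrite ?(dlt_morph f0 f1) ?nth3_morph.
Qed.

Lemma cG_morph t i j : f (cG o t i j) = cG o' (map (map f) t) i j.
Proof. by case: i j => [|i] [|j] /=; rewrite ?(dlt_morph f0 f1) ?nth2_morph. Qed.

Lemma map_mk3 F : map (map (map f)) (mk3 m F) = mk3 m (f3 F).
Proof.
by rewrite /mk3 -map_comp; apply: eq_map => i /=; rewrite -map_comp;
  apply: eq_map => j /=; rewrite -map_comp.
Qed.

Lemma map_mk2 F : map (map f) (mk2 m F) = mk2 m (f2 F).
Proof. by rewrite /mk2 -map_comp; apply: eq_map => i /=; rewrite -map_comp. Qed.

End SystemMorphism.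

(** * Tables and the numbering of their entries *)

Section Tables.
Variable T : Type.
Implicit Types (o : ops T) (m : nat).

Lemma nth3_mk3 o m F i j k : i < m -> j < m -> k < m -> nth3 o (mk3 m F) i j k =
  F i j k.
Proof.
by move=> im jm km; rewrite /nth3 /mk3 !(nth_map 0) ?size_iota // !nth_iota.
Qed.

Lemma nth2_mk2 o m F i j : i < m -> j < m -> nth2 o (mk2 m F) i j = F i j.
Proof.
by move=> im jm; rewrite /nth2 /mk2 !(nth_map 0) ?size_iota // !nth_iota.
Qed.

Lemma eq_mk3 m (F G : nat -> nat -> nat -> T) :
  (forall i j k, i < m -> j < m -> k < m -> F i j k = G i j k) ->
  mk3 m F = mk3 m G.
Proof.
move=> FG; apply/eq_in_map => i; rewrite mem_iota => /= im.
apply/eq_in_map => j; rewrite mem_iota => /= jm.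
by apply/eq_in_map => k; rewrite mem_iota => /= km; apply: FG.
Qed.

Lemma eq_mk2 m (F G : nat -> nat -> T) :
  (forall i j, i < m -> j < m -> F i j = G i j) -> mk2 m F = mk2 m G.
Proof.
move=> FG; apply/eq_in_map => i; rewrite mem_iota => /= im.
by apply/eq_in_map => j; rewrite mem_iota => /= jm; apply: FG.
Qed.

Lemma code2K m i j : j < m -> (i * m + j) %/ m = i /\ (i * m + j) %% m = j.
Proof.
move=> jm; have m0 : 0 < m by apply: leq_ltn_trans jm.
by rewrite divnMDl // divn_small // addn0 modnMDl modn_small.
Qed.

Lemma code2_lt m i j : i < m -> j < m -> i * m + j < m * m.
Proof.
move=> im jm; apply: (@leq_trans (i.+1 * m)); last by rewrite leq_mul2r im orbT.
by rewrite mulSn addnC ltn_add2r.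
Qed.

Lemma code3_lt m i j k : i < m -> j < m -> k < m -> code3 m i j k < m * m * m.
Proof.
move=> im jm km; apply: (@leq_trans ((i * m + j).+1 * m)).
  by rewrite /code3 mulSn addnC ltn_add2r.
by rewrite leq_mul2r code2_lt ?orbT.
Qed.

End Tables.

(** * Common zeros of the polynomial systems *)

Section PolynomialSystems.
Variable m : nat.
Implicit Types (e : nat -> bool).

(** Decodes a variable number, inverting [code3]; [env2] does the same for two consecutive square
    blocks. *)
Definition env3 (F : nat -> nat -> nat -> bool) v :=
  F (v %/ m %/ m) (v %/ m %% m) (v %% m).
Definition env2 p (F G : nat -> nat -> bool) v :=
  if v < p * p then F (v %/ p) (v %% p) else G ((v - p * p) %/ p)
    ((v - p * p) %% p).

Lemma env3_code F i j k : j < m -> k < m -> env3 F (code3 m i j k) = F i j k.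
Proof.
move=> jm km; rewrite /env3 /code3.
by have [-> ->] := code2K (i * m + j) km; have [-> ->] := code2K i jm.
Qed.

Lemma env2_codel p F G i j : i < p -> j < p -> env2 p F G (0 + (i * p + j)) = F i j.
Proof.
by move=> ip jp; rewrite /env2 add0n code2_lt //; have [-> ->] := code2K i jp.
Qed.

Lemma env2_coder p F G i j : j < p -> env2 p F G (p * p + (i * p + j)) = G i j.
Proof.
move=> jp; rewrite /env2 ltnNge leq_addr /= addKn.
by have [-> ->] := code2K i jp.
Qed.

Lemma peval_v3 F : map (map (map (peval (env3 F)))) (v3 m) = mk3 m F.
Proof.
by rewrite map_mk3; apply: eq_mk3 => i j k im jm km; rewrite peval_var env3_code.
Qed.

Lemma peval_v2l p F G : map (map (peval (env2 p F G))) (v2 p 0) = mk2 p F.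
Proof.
by rewrite map_mk2; apply: eq_mk2 => i j im jm; rewrite peval_var env2_codel.
Qed.

Lemma peval_v2r p F G : map (map (peval (env2 p F G))) (v2 p (p * p)) = mk2 p G.
Proof.
by rewrite map_mk2; apply: eq_mk2 => i j im jm; rewrite peval_var env2_coder.
Qed.

Lemma w3_env F w : (forall v, v < m * m * m -> nth false w v = env3 F v) ->
  w3 m w = mk3 m F.
Proof.
by move=> h; apply: eq_mk3 => i j k im jm km; rewrite h ?env3_code ?code3_lt.
Qed.

Lemma w2_envl p F G w :
  (forall v, v < 2 * (p * p) -> nth false w v = env2 p F G v) ->
  w2 p 0 w = mk2 p F.
Proof.
move=> h; apply: eq_mk2 => i j im jm; rewrite h ?env2_codel // add0n.
by apply: (leq_trans (code2_lt im jm)); rewrite mul2n -addnn leq_addr.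
Qed.

Lemma w2_envr p F G w :
  (forall v, v < 2 * (p * p) -> nth false w v = env2 p F G v) ->
  w2 p (p * p) w = mk2 p G.
Proof.
move=> h; apply: eq_mk2 => i j im jm; rewrite h ?env2_coder //.
by rewrite mul2n -addnn ltn_add2l code2_lt.
Qed.

Lemma all_peval e ps : all (fun p => ~~ peval e p) ps = zeros (map (peval e) ps).
Proof. by rewrite /zeros all_map; apply: eq_all. Qed.

Lemma fun3_ext T (F G : nat -> nat -> nat -> T) :
  (forall i j k, F i j k = G i j k) -> F = G.
Proof. by move=> h; apply/funext => i; apply/funext => j; apply/funext => k. Qed.

Lemma fun2_ext T (F G : nat -> nat -> T) : (forall i j, F i j = G i j) -> F = G.
Proof. by move=> h; apply/funext => i; apply/funext => j. Qed.

Let pM0 e : peval e (o0 pops) = o0 bops. Proof. by []. Qed.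
Let pM1 e : peval e (o1 pops) = o1 bops. Proof. by []. Qed.

(** Evaluation respects the operations, so it turns each polynomial of the system into the
    corresponding bit equation for the table of [F]. *)
Lemma M_sysE F : all (fun p => ~~ peval (env3 F) p) (M_sys m) =
  zeros (M_eqs m bops (cM bops (mk3 m F))).
Proof.
rewrite /M_sys all_peval (M_eqs_morph _ (pM0 _) (peval_add _) (peval_mul _));
  congr (zeros (M_eqs _ _ _)).
by apply: fun3_ext => i j k; rewrite (cM_morph (pM0 _) (pM1 _)) peval_v3.
Qed.

Lemma D_sysE t F : all (fun p => ~~ peval (env3 F) p) (D_sys m t) =
  zeros (D_eqs m bops (cM bops t) (cD bops (mk3 m F))).
Proof.
rewrite /D_sys all_peval (D_eqs_morph _ (pM0 _) (peval_add _) (peval_mul _)).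
apply/(congr1 zeros)/(f_equal2 (D_eqs m bops)).
  by apply: fun3_ext => i j k; rewrite peval_cst.
by apply: fun3_ext => i j k; rewrite (cD_morph (pM0 _) (pM1 _)) peval_v3.
Qed.

Lemma G_sysE F G : all (fun p => ~~ peval (env2 m F G) p) (G_sys m) =
  zeros (G_eqs m bops (cG bops (mk2 m F)) (cG bops (mk2 m G))).
Proof.
rewrite /G_sys all_peval
  (G_eqs_morph _ (pM0 _) (pM1 _) (peval_add _) (peval_mul _));
  congr (zeros (G_eqs _ _ _ _)).
  by apply: fun2_ext => i j; rewrite (cG_morph (pM0 _) (pM1 _)) peval_v2l.
by apply: fun2_ext => i j; rewrite (cG_morph (pM0 _) (pM1 _)) peval_v2r.
Qed.

Lemma S_sysE x F : all (fun p => ~~ peval (env2 m.+1 F F) p) (S_sys m x) =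
  zeros (S_eqs m bops (cM bops x.1) (cD bops x.2) (nth2 bops (mk2 m.+1 F))).
Proof.
rewrite /S_sys all_peval
  (S_eqs_morph _ (pM0 _) (pM1 _) (peval_add _) (peval_mul _));
  congr (zeros (S_eqs _ _ _ _ _)).
- by apply: fun3_ext => i j k; rewrite peval_cst.
- by apply: fun3_ext => i j k; rewrite peval_cst.
by apply: fun2_ext => i j; rewrite (nth2_morph (pM0 _)) peval_v2l.
Qed.

Lemma R_sysE x F G : all (fun p => ~~ peval (env2 m.+1 F G) p) (R_sys m x) =
  zeros (R_eqs m bops (cM bops x.1) (cD bops x.2) (nth2 bops (mk2 m.+1 F))
    (nth2 bops (mk2 m.+1 G))).
Proof.
rewrite /R_sys all_peval
  (R_eqs_morph _ (pM0 _) (pM1 _) (peval_add _) (peval_mul _));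
  congr (zeros (R_eqs _ _ _ _ _ _)).
- by apply: fun3_ext => i j k; rewrite peval_cst.
- by apply: fun3_ext => i j k; rewrite peval_cst.
- by apply: fun2_ext => i j; rewrite (nth2_morph (pM0 _)) peval_v2l.
by apply: fun2_ext => i j; rewrite (nth2_morph (pM0 _)) peval_v2r.
Qed.

End PolynomialSystems.

Local Open Scope ring_scope.

(** * Bases and coordinates *)

Section Basis.
Variable K : fieldType.

Lemma linear_sum_fun (U X : lmodType K) (f : U -> X) (fl : linear f)
    I r (P : pred I) (F : I -> U) :
  f (\sum_(i <- r | P i) F i) = \sum_(i <- r | P i) f (F i).
Proof.
pose f' := GRing.isLinear.Build _ _ _ _ f fl.
by pose g : {linear U -> X} := HB.pack f f'; apply: (linear_sum g).
Qed.

Lemma linearZ_fun (U X : lmodType K) (f : U -> X) (fl : linear f) a u :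
  f (a *: u) = a *: f u.
Proof.
pose f' := GRing.isLinear.Build _ _ _ _ f fl.
by pose g : {linear U -> X} := HB.pack f f'; apply: (linearZ_LR g).
Qed.

(** Carries its dual basis and is indexed by any finite type, so that a tensor product again has
    such a basis, indexed by pairs. *)
Record basis (V : lmodType K) (I : finType) := Basis {
  bv :> I -> V;
  bc : I -> {scalar V};
  bvK : forall v, v = \sum_i bc i v *: bv i;
  bcK : forall i j, bc i (bv j) = (i == j)%:R }.

Definition bilin (V W X : lmodType K) (b : V -> W -> X) :=
  (forall w, linear (b^~ w)) /\ (forall v, linear (b v)).

Section Lemmas.
Variables (V : lmodType K) (I : finType) (B : basis V I).

Lemma coord_inj u v : (forall i, bc B i u = bc B i v) -> u = v.
Proof.
by move=> h; rewrite (bvK B u) (bvK B v); apply: eq_bigr => i _; rewrite h.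
Qed.

Lemma bc_sum (x : I -> K) i : bc B i (\sum_j x j *: B j) = x i.
Proof.
rewrite linear_sum (bigD1 i) //= linearZ /= bcK eqxx mulr1 big1 ?addr0 // => j ji.
by rewrite linearZ /= bcK eq_sym (negPf ji) mulr0.
Qed.

Lemma linear_basisE (X : lmodType K) (f : V -> X) v : linear f ->
  f v = \sum_i bc B i v *: f (B i).
Proof.
move=> fl; rewrite {1}(bvK B v) linear_sum_fun //.
by apply: eq_bigr => i _; rewrite linearZ_fun.
Qed.

Lemma linear_basis_ext (X : lmodType K) (f g : V -> X) : linear f -> linear g ->
  (forall i, f (B i) = g (B i)) -> f =1 g.
Proof.
move=> fl gl fg v; rewrite (linear_basisE v fl) (linear_basisE v gl).
by apply: eq_bigr => i _; rewrite fg.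
Qed.

End Lemmas.

Lemma scalarP (V : lmodType K) (f : {scalar V}) : linear (f : V -> K^o).
Proof. by move=> a u v; rewrite linearP. Qed.

Section Tensors.
Variables (V W : vectType K) (I J : finType) (B : basis V I) (C : basis W J).

Definition tcoord (p : I * J) (t : tensor V W) : K :=
  tlift (fun u v => bc B p.1 u * bc C p.2 v : K^o) t.

Lemma tcoord_is_scalar p : scalar (tcoord p).
Proof. by move=> a s t; rewrite /tcoord tlift_is_linear. Qed.

HB.instance Definition _ p :=
  GRing.isLinear.Build K (tensor V W) K _ (tcoord p) (tcoord_is_scalar p).

Lemma tcoord_pure p u v : tcoord p (u \ox v) = bc B p.1 u * bc C p.2 v.
Proof.
rewrite /tcoord tlift_pure // => w a x y; rewrite linearP /=.
  by rewrite mulrDl -mulrA.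
by rewrite mulrDr mulrCA.
Qed.

Lemma pure_bilin : bilin (fun (u : V) (v : W) => u \ox v).
Proof.
split=> w; first exact: (pure_tensor_linear w (0 : V)).1.
exact: (pure_tensor_linear (0 : W) w).2.
Qed.

Lemma tbvK (t : tensor V W) : t = \sum_p tcoord p t *: (B p.1 \ox C p.2).
Proof.
move: t; apply: tensor_ext => // [a s t|u v].
  rewrite scaler_sumr -big_split; apply: eq_bigr => p _ /=.
  by rewrite linearP /= scalerDl scalerA.
have [pl pr] := pure_bilin.
rewrite {1}(bvK B u) (linear_sum_fun (pl v)).
under eq_bigr => i _ do rewrite (linearZ_fun (pl v)) {1}(bvK C v)
  (linear_sum_fun (pr _)) scaler_sumr.
rewrite pair_bigA; apply: eq_bigr => p _ /=.
by rewrite (linearZ_fun (pr _)) tcoord_pure scalerA.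
Qed.

Lemma tbcK p q : tcoord p (B q.1 \ox C q.2) = (p == q)%:R.
Proof. by rewrite tcoord_pure !bcK -natrM mulnb. Qed.

Definition tbasis : basis (tensor V W) (I * J)%type :=
  Basis (bv := fun p => B p.1 \ox C p.2) (bc := fun p => tcoord p :
    {scalar _}) tbvK tbcK.

Lemma tbasis_pure p u v : bc tbasis p (u \ox v) = bc B p.1 u * bc C p.2 v.
Proof. exact: tcoord_pure. Qed.

Lemma tliftE (X : vectType K) (b : V -> W -> X) t : bilin b ->
  tlift b t = \sum_i \sum_j bc tbasis (i, j) t *: b (B i) (C j).
Proof.
case=> bl br; rewrite (linear_basisE tbasis _ (tlift_is_linear b)) pair_bigA /=.
by apply: eq_bigr => -[i j] _; rewrite tlift_pure.
Qed.

End Tensors.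

Lemma tlift_pureE (V W X : vectType K) (b : V -> W -> X) u v :
  bilin b -> tlift b (u \ox v) = b u v.
Proof. by case=> bl br; apply: tlift_pure. Qed.

Lemma pure_comp_bilin (V W V' W' : vectType K) (f : V -> V') (g : W -> W') :
  linear f -> linear g -> bilin (fun u v => f u \ox g v).
Proof.
move=> fl gl; have [pl pr] := pure_bilin V' W'.
by split=> w a x y; rewrite ?fl ?gl ?pl ?pr.
Qed.

Lemma tmap_pure (V W V' W' : vectType K) (f : V -> V') (g : W -> W') u v :
  linear f -> linear g -> tmap f g (u \ox v) = f u \ox g v.
Proof. by move=> fl gl; rewrite /tmap tlift_pureE //; apply: pure_comp_bilin. Qed.

Lemma tmap_linear (V W V' W' : vectType K) (f : V -> V') (g : W -> W') :
  linear (tmap f g).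
Proof. exact: tlift_is_linear. Qed.

Lemma swap_bilin (V W : vectType K) : bilin (fun (u : V) (v : W) => v \ox u).
Proof. by have [pl pr] := pure_bilin W V; split. Qed.

Lemma assoc_inner_bilin (U V W : vectType K) (w : W) :
  bilin (fun (u : U) (v : V) => u \ox (v \ox w)).
Proof.
have [pl pr] := pure_bilin U (tensor V W); have [ql qr] := pure_bilin V W.
by split=> [v|u] a x y; rewrite ?ql ?pl ?pr.
Qed.

Lemma assoc_bilin (U V W : vectType K) :
  bilin (fun (s : tensor U V) (w :
    W) => tlift (fun (u : U) (v : V) => u \ox (v \ox w)) s).
Proof.
split=> [w|s]; first exact: tlift_is_linear.
move=> a x y; apply: tlift_linear_fun => u v.
have [pl pr] := pure_bilin U (tensor V W); have [ql qr] := pure_bilin V W.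
by rewrite qr pr.
Qed.

Lemma tassoc_linear (U V W : vectType K) : linear (@tassoc K U V W).
Proof. exact: tlift_is_linear. Qed.

Lemma tassoc_pure (U V W : vectType K) (u : U) (v : V) (w : W) :
  tassoc ((u \ox v) \ox w) = u \ox (v \ox w).
Proof.
rewrite /tassoc tlift_pureE; last exact: assoc_bilin.
by rewrite tlift_pureE //; apply: assoc_inner_bilin.
Qed.

Lemma basis_of_tuple (V : vectType K) n (X : n.-tuple V) : basis_of fullv X ->
  exists B : basis V 'I_n, forall i, B i = X`_i.
Proof.
move=> bX.
have vK v : v = \sum_(i < n) coord X i v *: X`_i.
  by apply: coord_basis bX _; rewrite memvf.
have cK (i j : 'I_n) : coord X i X`_j = (i == j)%:R.
  by rewrite coord_free ?(basis_free bX) // eq_sym.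
by exists (Basis (bv := fun i : 'I_n => X`_i) (bc := fun i : 'I_n => coord X i :
  {scalar V}) vK cK).
Qed.

(** The matrices of the two changes of basis between [B] and the coordinates underlying [V] are
    mutually inverse, which bounds each size by the other. *)
Lemma basis_dim (V : vectType K) n (B : basis V 'I_n) : \dim {: V} = n.
Proof.
rewrite dimvf; apply/eqP; rewrite eqn_leq.
pose A := \matrix_(i < n, j < dim V) v2r (B i) 0 j.
pose A' := \matrix_(i < dim V, j < n) bc B j (basis_vec i).
have AA' : A *m A' = 1%:M.
  apply/matrixP => i k;
    rewrite !mxE eq_sym -(bcK B) [in RHS](vec_basis (B i)) linear_sum.
  by apply: eq_bigr => j _; rewrite !mxE linearZ.
have A'A : A' *m A = 1%:M.
  apply/matrixP => j k.
  have -> : (1%:M : 'M[K]_(dim V)) j k = v2r (basis_vec j) 0 k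
    by rewrite /basis_vec r2vK !mxE eqxx eq_sym.
  rewrite [in RHS](bvK B (basis_vec j)) linear_sum summxE mxE.
  by apply: eq_bigr => i _; rewrite !mxE linearZ mxE.
by rewrite (mulmx1_min AA') (mulmx1_min A'A).
Qed.

End Basis.

(** * Coordinates of tensor operations *)

Section Coordinates.
Variables (K : fieldType) (I : finType).

Lemma sum_deltar (F : I -> K) i : \sum_j F j * (i == j)%:R = F i.
Proof.
rewrite (bigD1 i) //= eqxx mulr1 big1 ?addr0 // => j ji.
by rewrite eq_sym (negPf ji) mulr0.
Qed.

Lemma sum_deltal (F : I -> K) i : \sum_j (i == j)%:R * F j = F i.
Proof. by rewrite -[RHS]sum_deltar; apply: eq_bigr => j _; rewrite mulrC. Qed.

Lemma tassoc_coord (I1 I2 I3 : finType) (U V W : vectType K) (B : basis U I1) (C :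
  basis V I2) (E : basis W I3) a b c s :
  bc (tbasis B (tbasis C E)) (a, (b, c)) (tassoc s) =
    bc (tbasis (tbasis B C) E) ((a, b), c) s.
Proof.
move: s; apply: (@tensor_ext _ _ _ K^o) => [||s w].
- by move=> k x y; rewrite tassoc_linear linearP.
- exact: scalarP.
have [_ pr] := assoc_bilin U V W.
rewrite !tbasis_pure /=; move: s; apply: (@tensor_ext _ _ _ K^o) => [||u v].
- move=> k x y; rewrite (pure_tensor_linear w (0 : tensor U V)).1 tassoc_linear
  linearP //.
- by move=> k x y; rewrite linearP /= mulrDl -mulrA.
by rewrite tassoc_pure !tbasis_pure /= mulrA.
Qed.

Lemma tmap_coord (I1 I2 J1 J2 : finType) (V W V' W' : vectType K) (B :
  basis V I1) (C : basis W I2) (B' : basis V' J1) (C' : basis W' J2)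
  (f : V -> V') (g : W -> W') t p : linear f -> linear g ->
  bc (tbasis B' C') p (tmap f g t) =
  \sum_i \sum_j bc (tbasis B C) (i, j) t *
    (bc B' p.1 (f (B i)) * bc C' p.2 (g (C j))).
Proof.
move=> fl gl; rewrite /tmap (tliftE B C) ?linear_sum; last exact: pure_comp_bilin.
apply: eq_bigr => i _; rewrite linear_sum; apply: eq_bigr => j _.
by rewrite linearZ /= tcoord_pure.
Qed.

Lemma tmul_coord (A A' : falgType K) (J : finType) (B : basis A I) (B' :
  basis A' J) (s t : tensor A A') k l :
  bc (tbasis B B') (k, l) (s * t) =
  \sum_a \sum_b bc (tbasis B B') (a, b) s * \sum_c \sum_e
    bc (tbasis B B') (c, e) t * (bc B k (B a * B c) * bc B' l (B' b * B' e)).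
Proof.
rewrite {1}(bvK (tbasis B B') s) mulr_suml linear_sum [RHS]pair_bigA.
apply: eq_bigr => -[a b] _ /=; rewrite -scalerAl linearZ /=; congr (_ * _).
rewrite {1}(bvK (tbasis B B') t) mulr_sumr linear_sum [RHS]pair_bigA.
apply: eq_bigr => -[c e] _ /=; rewrite -scalerAr linearZ /=; congr (_ * _).
by rewrite pure_tensorM tcoord_pure.
Qed.

End Coordinates.

(** * Structure constants of a bialgebra *)

Section Constants.
Variables (K : fieldType) (I : finType) (o : I).
Implicit Types (M D : I -> I -> I -> K) (H : bialgebra K).

Definition presents H (B : basis H I) M D :=
  [/\ B o = 1, forall i, counit H (B i) = (i == o)%:R,
      forall i j k, bc B k (B i * B j) = M i j k
    & forall i j k, bc (tbasis B B) (j, k) (coprod H (B i)) = D i j k].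

Definition has_consts H M D := exists B : basis H I, presents B M D.

(** The first two clauses make the basis vector [o] a unit. The third is multiplicativity of the
    counit, which is the coordinate [o]. *)
Definition alg_consts M :=
  [/\ forall j k, M o j k = (j == k)%:R, forall i k, M i o k = (i == k)%:R,
      forall i j, M i j o = (i == o)%:R * (j == o)%:R
    & forall i j k l, \sum_x M i j x * M x k l = \sum_x M j k x * M i x l].

(** In order: Delta 1 = 1 (x) 1, the two counit axioms, coassociativity, and multiplicativity of
    Delta. *)
Definition coalg_consts M D :=
  [/\ forall j k, D o j k = (j == o)%:R * (k == o)%:R, forall i k, D i o k =
    (i == k)%:R,
      forall i j, D i j o = (i == j)%:R,
      forall i a b c, \sum_x D i x c * D x a b = \sum_x D i a x * D x b c
    & forall i j k l, \sum_x M i j x * D x k l =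
        \sum_a \sum_b D i a b * \sum_c \sum_e D j c e * (M a c k * M b e l)].

Section Presented.
Variables (H : bialgebra K) (B : basis H I) (M D : I -> I -> I -> K).
Hypothesis p : presents B M D.

Lemma presM i j : B i * B j = \sum_k M i j k *: B k.
Proof.
have [_ _ h _] := p; rewrite (bvK B (_ * _)).
by apply: eq_bigr => k _; rewrite h.
Qed.

Lemma presD i : coprod H (B i) = \sum_j \sum_k D i j k *: (B j \ox B k).
Proof.
have [_ _ _ h] := p; rewrite (bvK (tbasis B B) (coprod _ _)) pair_bigA.
by apply: eq_bigr => -[j k] _; rewrite h.
Qed.

Lemma pres1 i : bc B i 1 = (i == o)%:R.
Proof. by have [<- _ _ _] := p; rewrite bcK. Qed.

Lemma counit_coord v : counit H v = bc B o v :> K.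
Proof.
have [_ h2 _ _] := p.
rewrite {1}(bvK B v) linear_sum (bigD1 o) //= linearZ /= h2 eqxx big1
  ?addr0 => [|i io].
  by rewrite /GRing.scale /= mulr1.
by rewrite linearZ /= h2 (negPf io) /GRing.scale /= mulr0.
Qed.

Lemma presents_alg_consts : alg_consts M.
Proof.
have [h1 h2 h3 h4] := p; split.
- by move=> j k; rewrite -h3 h1 mul1r bcK eq_sym.
- by move=> i k; rewrite -h3 h1 mulr1 bcK eq_sym.
- by move=> i j; rewrite -h3 -counit_coord rmorphM /= !h2.
move=> i j k l; transitivity (bc B l (B i * B j * B k)).
  rewrite presM mulr_suml linear_sum; apply: eq_bigr => x _.
  by rewrite -scalerAl linearZ /= h3.
rewrite -mulrA presM mulr_sumr linear_sum; apply: eq_bigr => x _.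
by rewrite -scalerAr linearZ /= h3.
Qed.

Lemma counit_bilinl : bilin (fun a b : H => counit H a *: b).
Proof.
split=> w a x y; first by rewrite linearP /= scalerDl -scalerA.
by rewrite scalerDr !scalerA mulrC.
Qed.

Lemma counit_bilinr : bilin (fun a b : H => counit H b *: a).
Proof.
split=> w a x y; last by rewrite linearP /= scalerDl -scalerA.
by rewrite scalerDr !scalerA mulrC.
Qed.

Lemma presents_coalg_consts : coalg_consts M D.
Proof.
have [h1 h2 h3 h4] := p.
split.
- move=> j k; rewrite -h4 h1 rmorph1.
  by rewrite tensor1E tbasis_pure /= !pres1.
- move=> i k; have := counitL (B i); rewrite (tliftE B B);
  last exact: counit_bilinl.
  move/(congr1 (bc B k)); rewrite bcK eq_sym => <-.
  rewrite linear_sum (bigD1 o) //= [X in _ + X]big1 => [|j jo].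
    rewrite addr0 linear_sum (bigD1 k) //= !linearZ /= h2 h4 eqxx bcK eqxx !mulr1.
    rewrite big1 ?addr0 // => j jk.
    by rewrite !linearZ /= bcK eq_sym (negPf jk) !mulr0.
  by rewrite linear_sum big1 // => k' _;
    rewrite h2 (negPf jo) scale0r scaler0 linear0.
- move=> i k; have := counitR (B i); rewrite (tliftE B B);
  last exact: counit_bilinr.
  move/(congr1 (bc B k)); rewrite bcK eq_sym => <-.
  rewrite linear_sum (bigD1 k) //= [X in _ + X]big1 => [|j jk].
    rewrite addr0 linear_sum (bigD1 o) //= !linearZ /= h2 h4 eqxx bcK eqxx !mulr1.
    rewrite big1 ?addr0 // => j jo.
    by rewrite h2 (negPf jo) scale0r scaler0 linear0.
  by rewrite linear_sum big1 // => k' _;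
    rewrite !linearZ /= bcK eq_sym (negPf jk) !mulr0.
- move=> i a b c; have := coprodA (B i).
  move/(congr1 (bc (tbasis B (tbasis B B)) (a, (b, c)))).
  rewrite tassoc_coord (tmap_coord B B (tbasis B B) B) //; last exact: linearP.
  rewrite (tmap_coord B B B (tbasis B B)) //=; last exact: linearP.
  under eq_bigr => x _ do (under eq_bigr => y _ do rewrite !h4 bcK mulrA;
    rewrite sum_deltar).
  move=> ->; rewrite exchange_big /=; apply: eq_bigr => y _.
  by under eq_bigr => x _ do rewrite !h4 bcK mulrCA; rewrite sum_deltal.
move=> i j k l; transitivity (bc (tbasis B B) (k, l) (coprod H (B i * B j))).
  rewrite presM !linear_sum; apply: eq_bigr => x _.
  by rewrite !linearZ /= h4.
rewrite rmorphM tmul_coord; apply: eq_bigr => a _; apply: eq_bigr => b _.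
by rewrite h4; congr (_ * _); apply: eq_bigr => c _; apply: eq_bigr => e _;
  rewrite h4 !h3.
Qed.

End Presented.
End Constants.

(** * Isomorphisms and changes of basis *)

Section Isomorphisms.
Variables (K : fieldType) (I : finType) (o : I).
Implicit Types (M D : I -> I -> I -> K) (H : bialgebra K) (g h : I -> I -> K).

(** The linear map matching the two bases respects product, coproduct and counit, since on basis
    vectors each is given by the same constants. *)
Lemma presents_isom H H' (B : basis H I) (B' : basis H' I) M D :
  presents o B M D -> presents o B' M D -> bialg_isom H H'.
Proof.
move=> p p'; have [p1 p2 _ _] := p; have [p1' p2' _ _] := p'.
pose f (u : H) : H' := \sum_i bc B i u *: B' i.
pose f' (u : H') : H := \sum_i bc B' i u *: B i.
have fB i : f (B i) = B' i.
  rewrite /f (bigD1 i) //= bcK eqxx scale1r big1 ?addr0 // => j ji.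
  by rewrite bcK (negPf ji) scale0r.
have fl : linear f.
  move=> a u v; rewrite /f scaler_sumr -big_split; apply: eq_bigr => i _ /=.
  by rewrite linearP scalerDl scalerA.
have fK : cancel f f'.
  by move=> u; rewrite [RHS](bvK B); apply: eq_bigr => i _; rewrite bc_sum.
have f'K : cancel f' f.
  by move=> u; rewrite [RHS](bvK B'); apply: eq_bigr => i _; rewrite bc_sum.
have f1 : f 1 = 1 by rewrite -p1 fB p1'.
have fM : {morph f : u v / u * v}.
  move=> u v; move: u; apply: (linear_basis_ext (B := B)) => [k x y|k x y|i].
  - by rewrite mulrDl -scalerAl fl.
  - by rewrite fl mulrDl -scalerAl.
  move: v; apply: (linear_basis_ext (B := B)) => [k x y|k x y|j].
  - by rewrite mulrDr -scalerAr fl.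
  - by rewrite fl mulrDr -scalerAr.
  rewrite !fB (presM p) (presM p') (linear_sum_fun fl); apply: eq_bigr => k _.
  by rewrite (linearZ_fun fl) fB.
pose mf := GRing.isMonoidMorphism.Build _ _ f (conj f1 fM).
pose lf := GRing.isLinear.Build _ _ _ _ f fl.
pose F : {lrmorphism H -> H'} := HB.pack f mf lf.
exists F; split.
- by exists f'.
- apply: (linear_basis_ext (B := B)) => [k x y|k x y|i].
  + by rewrite !linearP.
  + by rewrite linearP tmap_linear.
  rewrite /= fB (presD p) (presD p') (linear_sum_fun (tmap_linear _ _));
    apply: eq_bigr => j _.
  rewrite (linear_sum_fun (tmap_linear _ _)); apply: eq_bigr => k _.
  rewrite (linearZ_fun (tmap_linear _ _)); congr (_ *: _).
  by have := tmap_pure (B j) (B k) fl fl; rewrite !fB => <-.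
apply: (linear_basis_ext (X := K^o) (B := B)) => [k x y|k x y|i].
- by rewrite !linearP.
- by rewrite !linearP.
by rewrite /= fB p2 p2'.
Qed.

(** The image of the basis under the isomorphism, with coordinates pulled back along its inverse,
    has the same constants. *)
Lemma isom_presents H H' (B : basis H I) M D :
  presents o B M D -> bialg_isom H H' -> has_consts o H' M D.
Proof.
case=> p1 p2 p3 p4 [f [[f' fK f'K] fD fe]].
have f'l : linear f' by move=> a u v; apply: (can_inj fK);
  rewrite f'K linearP /= !f'K.
have bl i : scalar (fun v => bc B i (f' v)) by move=> a u v; rewrite f'l linearP.
pose b i : {scalar H'} :=
  HB.pack (fun v => bc B i (f' v))
  (GRing.isLinear.Build _ _ _ _ (fun v => bc B i (f' v)) (bl i)).
have bK v : v = \sum_i b i v *: f (B i).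
  rewrite -[LHS]f'K {1}(bvK B (f' v)) linear_sum; apply: eq_bigr => i _.
  by rewrite linearZ.
have bE i j : b i (f (B j)) = (i == j)%:R by rewrite /= fK bcK.
exists (Basis bK bE); split=> [|i|i j k|i j k] /=.
- by rewrite p1 rmorph1.
- by rewrite fe p2.
- by rewrite -rmorphM fK p3.
rewrite fD (tmap_coord B B); try exact: linearP.
rewrite -p4 [RHS](_ : _ = \sum_x \sum_y bc (tbasis B B) (x, y) (coprod H (B i)) *
  ((j == x)%:R * (k == y)%:R)).
  by apply: eq_bigr => x _; apply: eq_bigr => y _; rewrite /= !fK !bcK.
under eq_bigr => x _ do (under eq_bigr => y _ do rewrite mulrA; rewrite sum_deltar).
by rewrite sum_deltar.
Qed.

Definition chM g h M i j k := \sum_a g i a * \sum_b g j b * \sum_c h c k * M a b c.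
Definition chD g h D i j k := \sum_a g i a * \sum_b h b j * \sum_c h c k * D a b c.

(** The condition on row [o] keeps 1 as basis vector; the one on column [o] says that the counit is
    unchanged. *)
Definition unital g :=
  (forall j, g o j = (o == j)%:R) /\ (forall i, g i o = (i == o)%:R).
Definition mutinv g h :=
  (forall i j, \sum_x g i x * h x j = (i == j)%:R) /\
    (forall i j, \sum_x h i x * g x j = (i == j)%:R).

Section TwoBases.
Variables (V W : vectType K) (B B' : basis V I) (C C' : basis W I).

Lemma change_coord k v : bc B' k v = \sum_c bc B' k (B c) * bc B c v.
Proof.
rewrite {1}(bvK B v) linear_sum; apply: eq_bigr => c _.
by rewrite linearZ /= mulrC.
Qed.

Lemma change_tcoord j k t : bc (tbasis B' C') (j, k) t =
  \sum_b bc B' j (B b) * \sum_c bc C' k (C c) * bc (tbasis B C) (b, c) t.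
Proof.
rewrite {1}(bvK (tbasis B C) t) linear_sum.
under [RHS]eq_bigr => b _ do rewrite mulr_sumr.
rewrite [RHS]pair_bigA; apply: eq_bigr => -[b c] _.
by rewrite linearZ /= tcoord_pure mulrC mulrA.
Qed.

End TwoBases.

Lemma presents_change H (B B' : basis H I) M D M' D' :
  presents o B M D -> presents o B' M' D' ->
  let g i j := bc B j (B' i) in let h i j := bc B' j (B i) in
  (forall i j k, M' i j k = chM g h M i j k) /\
    (forall i j k, D' i j k = chD g h D i j k).
Proof.
move=> [_ _ pM pD] [_ _ pM' pD'] g h; split=> i j k.
  rewrite -pM' (change_coord B) {1}(bvK B (B' i)).
  under [LHS]eq_bigr => c _ do rewrite mulr_suml (linear_sum (bc B c)) mulr_sumr.
  rewrite exchange_big; apply: eq_bigr => a _ /=.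
  under [LHS]eq_bigr => c _ do rewrite -scalerAl linearZ /= mulrCA.
  rewrite -mulr_sumr; congr (_ * _); rewrite {1}(bvK B (B' j)).
  under [LHS]eq_bigr => c _ do rewrite [B a * _]mulr_sumr
    (linear_sum (bc B c)) mulr_sumr.
  rewrite exchange_big; apply: eq_bigr => b _ /=.
  under [LHS]eq_bigr => c _ do rewrite -scalerAr linearZ /= mulrCA pM.
  by rewrite -mulr_sumr.
rewrite -pD' (change_tcoord B _ B) {1}(bvK B (B' i)).
under [LHS]eq_bigr => b _ do
  (under eq_bigr => c _ do rewrite linear_sum
  (linear_sum (bc (tbasis B B) (b, c))) mulr_sumr;
  rewrite exchange_big mulr_sumr).
rewrite exchange_big; apply: eq_bigr => a _ /=; rewrite mulr_sumr;
  apply: eq_bigr => b _.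
rewrite mulrCA; congr (_ * _); rewrite mulr_sumr; apply: eq_bigr => c _.
by rewrite !linearZ /= pD mulrCA.
Qed.

(** The matrix [g] expresses the second basis in the first. It is unital because both bases contain
    1 at index [o] and have the counit as coordinate [o]. *)
Lemma has_consts_unique H M D M' D' : has_consts o H M D -> has_consts o H M' D' ->
  exists g h, [/\ mutinv g h, unital g, unital h,
    forall i j k, M' i j k = chM g h M i j k & forall i j k, D' i j k =
      chD g h D i j k].
Proof.
move=> [B p] [B' p']; have [hM hD] := presents_change p p'.
exists (fun i j => bc B j (B' i)), (fun i j => bc B' j (B i)).
have inv (C C' : basis H I) i j : \sum_x bc C x (C' i) * bc C' j (C x) =
  (i == j)%:R.
  by under eq_bigr do rewrite mulrC; rewrite -change_coord bcK eq_sym.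
have un (C C' : basis H I) N E N' E' : presents o C N E -> presents o C' N' E' ->
    unital (fun i j => bc C j (C' i)).
  move=> q [q1 q2 _ _]; split=> i /=; first by rewrite q1 (pres1 q) eq_sym.
  by rewrite -(counit_coord q) q2.
split=> //; [exact: un p p'|exact: un p' p].
Qed.

Lemma has_consts_change H M D g h : has_consts o H M D -> mutinv g h -> unital g ->
  has_consts o H (chM g h M) (chD g h D).
Proof.
move=> [B p] [gh hg] [g1 g2]; have [p1 p2 _ _] := p.
pose b i := \sum_j g i j *: B j.
have cl i : scalar (fun v => \sum_j bc B j v * h j i).
  move=> a u v; rewrite mulr_sumr -big_split; apply: eq_bigr => j _ /=.
  by rewrite linearP /= mulrDl mulrA.
pose c i : {scalar H} := HB.pack (fun v => \sum_j bc B j v * h j i)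
  (GRing.isLinear.Build _ _ _ _ (fun v => \sum_j bc B j v * h j i) (cl i)).
have cB i j : c i (B j) = h j i.
  rewrite /c /=; under eq_bigr => x _ do rewrite bcK eq_sym.
  exact: (sum_deltal (fun x => h x i)).
have bK v : v = \sum_i c i v *: b i.
  rewrite {1}(bvK B v).
  under [RHS]eq_bigr => i _ do rewrite scaler_sumr.
  rewrite exchange_big; apply: eq_bigr => j _ /=.
  under eq_bigr => i _ do rewrite scalerA.
  rewrite -scaler_suml; congr (_ *: _).
  under eq_bigr => i _ do rewrite mulr_suml.
  rewrite exchange_big /=.
  under eq_bigr => x _ do (under eq_bigr => i _ do rewrite -mulrA;
    rewrite -mulr_sumr hg eq_sym).
  by rewrite (sum_deltar (fun x => bc B x v)).
have bE i j : c i (b j) = (i == j)%:R.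
  rewrite /b linear_sum.
  under eq_bigr => x _ do rewrite linearZ /= -[X in _ * X]/(c i (B x)) cB.
  by rewrite gh eq_sym.
pose B' := Basis bK bE.
(* The constants are first taken to be whatever the new basis yields; the comparison of two bases
   then computes them. *)
pose M' i j k := bc B' k (B' i * B' j); pose D' i j k :=
  bc (tbasis B' B') (j, k) (coprod H (B' i)).
have p' : presents o B' M' D'.
  split=> // [|i]; rewrite /= /b.
    rewrite (bigD1 o) //= g1 eqxx scale1r p1 big1 ?addr0 // => j jo.
    by rewrite g1 eq_sym (negPf jo) scale0r.
  by rewrite (counit_coord p) bc_sum g2.
have [hM hD] := presents_change p p'.
have gE i j : bc B j (B' i) = g i j by rewrite /= /b bc_sum.
have hE i j : bc B' j (B i) = h i j by rewrite -cB.
exists B'; split=> // [|i|i j k|i j k]; try by case: p'.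
- have := hM i j k; rewrite /M' => ->; rewrite /chM; apply: eq_bigr => a _;
  rewrite gE; congr (_ * _).
  by apply: eq_bigr => b' _; rewrite gE; congr (_ * _); apply: eq_bigr => c' _;
    rewrite hE.
have := hD i j k; rewrite /D' => ->; rewrite /chD; apply: eq_bigr => a _;
  rewrite gE; congr (_ * _).
by apply: eq_bigr => b' _; rewrite hE; congr (_ * _); apply: eq_bigr => c' _;
  rewrite hE.
Qed.

End Isomorphisms.

(** Since the counit maps 1 to 1, it is onto and its kernel has codimension 1; adjoining 1 to a
    basis of the kernel gives a basis of H. *)
Lemma adapted_basis (K : fieldType) n (H : bialgebra K) : \dim {:H} = n.+1 ->
  exists B : basis H 'I_n.+1, B ord0 = 1 /\ forall i, counit H (B i) =
    (i == ord0)%:R.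
Proof.
move=> dH; pose e : 'Hom(H, K^o) := linfun (counit H).
have e1 : e 1 = 1 by rewrite lfunE /= rmorph1.
have dK : \dim (lker e) = n.
  have := limg_ker_dim e fullv; rewrite capfv dH.
  suff -> : \dim (limg e) = 1%N by rewrite addn1 => -[].
  apply/eqP; rewrite eqn_leq; apply/andP; split.
    by apply: (leq_trans (dimvS (subvf _))); rewrite dimvf.
  rewrite lt0n dimv_eq0; apply: contraNneq (oner_neq0 K^o) => e0.
  by rewrite -memv0 -e0 -e1 memv_img ?memvf.
have kX x : x \in vbasis (lker e) -> e x = 0.
  by move=> /vbasis_mem; rewrite memv_ker => /eqP.
have sX : size (1 :: vbasis (lker e)) == n.+1 by rewrite /= size_tuple dK.
pose X := Tuple sX.
have bX : basis_of fullv X.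
  rewrite basisEfree subvf size_tuple dH leqnn andbT; apply/andP; split=> //.
  rewrite free_cons (basis_free (vbasisP _)) andbT
    (span_basis (vbasisP _)) memv_ker e1.
  exact: oner_neq0.
have [B hB] := basis_of_tuple bX; exists B; split=> [|i]; first by rewrite hB.
rewrite hB; case: i => -[|i] hi /=; first by rewrite rmorph1.
have ii : (i < size (vbasis (lker e)))%N by rewrite size_tuple dK.
by have := kX _ (mem_nth 0 ii); rewrite lfunE.
Qed.

Lemma has_consts_exists (K : fieldType) n (H : bialgebra K) : \dim {:H} = n.+1 ->
  exists M D, has_consts (ord0 : 'I_n.+1) H M D.
Proof.
move=> /adapted_basis[B [h1 h2]].
by exists (fun i j k => bc B k (B i * B j)),
  (fun i j k => bc (tbasis B B) (j, k) (coprod H (B i))), B.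
Qed.

(** * The bialgebra with given structure constants *)

(** The axioms are a parameter of the alias, so that each [M] can put its own algebra structure on
    the same row vectors. *)
Definition model (K : fieldType) n (o : 'I_n) (M : 'I_n -> 'I_n -> 'I_n -> K)
  (_ : alg_consts o M) : Type := 'rV[K]_n.

Section Model.
Variables (K : fieldType) (n : nat) (o : 'I_n) (M : 'I_n -> 'I_n -> 'I_n -> K).
Hypothesis aM : alg_consts o M.

HB.instance Definition _ := Vector.copy (model aM) 'rV[K]_n.

Definition mbv (i : 'I_n) : model aM := delta_mx 0 i.
Definition mcoord (i : 'I_n) (u : model aM) : K := (u : 'rV_n) 0 i.

Fact mcoord_scalar i : scalar (mcoord i).
Proof. by move=> a u v; rewrite /mcoord !mxE. Qed.

HB.instance Definition _ i :=
  GRing.isLinear.Build K (model aM) K _ (mcoord i) (mcoord_scalar i).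

Fact mbvK (u : model aM) : u = \sum_i mcoord i u *: mbv i.
Proof. exact: row_sum_delta. Qed.

Fact mbcK i j : mcoord i (mbv j) = (i == j)%:R.
Proof. by rewrite /mcoord mxE eqxx. Qed.

Definition model_basis : basis (model aM) 'I_n :=
  Basis (bv := mbv) (bc := fun i => mcoord i : {scalar _}) mbvK mbcK.

Definition model_mul (u v : model aM) : model aM :=
  \sum_i \sum_j (mcoord i u * mcoord j v) *: \sum_k M i j k *: mbv k.

Fact model_mul_bilin : bilin model_mul.
Proof.
split=> w a u v; rewrite /model_mul scaler_sumr -big_split;
  apply: eq_bigr => i _ /=;
rewrite scaler_sumr -big_split; apply: eq_bigr => j _ /=; rewrite linearP /=.
  by rewrite mulrDl scalerDl -mulrA scalerA.
by rewrite mulrDr scalerDl mulrCA scalerA.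
Qed.

Fact model_mul_mbv i j : model_mul (mbv i) (mbv j) = \sum_k M i j k *: mbv k.
Proof.
rewrite /model_mul (bigD1 i) //= [X in _ + X]big1 => [|i' ii]; last first.
  by rewrite big1 // => j' _; rewrite !mbcK (negPf ii) mul0r scale0r.
rewrite addr0 (bigD1 j) //= [X in _ + X]big1 => [|j' jj]; last first.
  by rewrite !mbcK (negPf jj) mulr0 scale0r.
by rewrite addr0 !mbcK !eqxx mulr1 scale1r.
Qed.

Fact model_mulA : associative model_mul.
Proof.
have [ml mr] := model_mul_bilin; have [_ _ _ a4] := aM.
move=> u v w; move: u;
  apply: (linear_basis_ext (B := model_basis)) => [k x y|k x y|i].
- by rewrite ml.
- by rewrite !ml.
move: v; apply: (linear_basis_ext (B := model_basis)) => [k x y|k x y|j].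
- by rewrite ml mr.
- by rewrite mr ml.
move: w; apply: (linear_basis_ext (B := model_basis)) => [k x y|k x y|k].
- by rewrite !mr.
- by rewrite mr.
rewrite !model_mul_mbv (linear_sum_fun (mr _)) (linear_sum_fun (ml _)).
under eq_bigr => x _ do rewrite (linearZ_fun (mr _)) model_mul_mbv scaler_sumr.
under [RHS]eq_bigr => x _ do rewrite (linearZ_fun (ml _)) model_mul_mbv scaler_sumr.
rewrite exchange_big [RHS]exchange_big; apply: eq_bigr => l _ /=.
under eq_bigr => x _ do rewrite scalerA.
under [RHS]eq_bigr => x _ do rewrite scalerA.
by rewrite -!scaler_suml a4.
Qed.

Fact model_mul1 : left_id (mbv o) model_mul.
Proof.
have [ml mr] := model_mul_bilin; have [a1 _ _ _] := aM.
apply: (linear_basis_ext (B := model_basis)) => // i; rewrite model_mul_mbv.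
rewrite (bigD1 i) //= a1 eqxx scale1r big1 ?addr0 // => j ji.
by rewrite a1 eq_sym (negPf ji) scale0r.
Qed.

Fact model_mulr1 : right_id (mbv o) model_mul.
Proof.
have [ml mr] := model_mul_bilin; have [_ a1 _ _] := aM.
apply: (linear_basis_ext (B := model_basis)) => // i; rewrite model_mul_mbv.
rewrite (bigD1 i) //= a1 eqxx scale1r big1 ?addr0 // => j ji.
by rewrite a1 eq_sym (negPf ji) scale0r.
Qed.

Fact model_mulDl : left_distributive model_mul +%R.
Proof. by move=> u v w; rewrite -[u]scale1r (model_mul_bilin.1 w) !scale1r. Qed.

Fact model_mulDr : right_distributive model_mul +%R.
Proof. by move=> w u v; rewrite -[u]scale1r (model_mul_bilin.2 w) !scale1r. Qed.

Fact mone_neq0 : mbv o != 0.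
Proof.
apply: contraNneq (oner_neq0 K) => e; have := mbcK o o.
by rewrite e linear0 eqxx => /esym/eqP.
Qed.

HB.instance Definition _ := GRing.Zmodule_isNzRing.Build (model aM)
  model_mulA model_mul1 model_mulr1 model_mulDl model_mulDr mone_neq0.

Fact mscaleAl (k : K) (u v : model aM) : k *: (u * v) = k *: u * v.
Proof. exact: esym (linearZ_fun (model_mul_bilin.1 v) k u). Qed.

HB.instance Definition _ := GRing.Lmodule_isLalgebra.Build K (model aM) mscaleAl.

Fact mscaleAr (k : K) (u v : model aM) : k *: (u * v) = u * (k *: v).
Proof. exact: esym (linearZ_fun (model_mul_bilin.2 u) k v). Qed.

HB.instance Definition _ := GRing.Lalgebra_isAlgebra.Build K (model aM) mscaleAr.
HB.instance Definition _ := Algebra_isFalgebra.Build K (model aM).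

Lemma dim_model : \dim {: model aM} = n.
Proof. by rewrite dimvf [LHS]mul1n. Qed.

Variable D : 'I_n -> 'I_n -> 'I_n -> K.
Hypothesis aD : coalg_consts o M D.
Local Notation A := (model aM).
Local Notation e := (model_basis).

Definition mcop (u : A) : tensor A A :=
  \sum_i bc e i u *: \sum_j \sum_k D i j k *: (e j \ox e k).

Fact mcop_linear : linear mcop.
Proof.
move=> a u v; rewrite /mcop scaler_sumr -big_split; apply: eq_bigr => i _ /=.
by rewrite linearP scalerDl scalerA.
Qed.

Fact mcop_mbv i : mcop (e i) = \sum_j \sum_k D i j k *: (e j \ox e k).
Proof.
rewrite /mcop (bigD1 i) //= mbcK eqxx scale1r [X in _ + X]big1 ?addr0 // => j ji.
by rewrite mbcK (negPf ji) scale0r.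
Qed.

Fact mcop_coord i p : bc (tbasis e e) p (mcop (e i)) = D i p.1 p.2.
Proof.
rewrite mcop_mbv pair_bigA /=.
exact: (bc_sum (tbasis e e) (fun p => D i p.1 p.2)).
Qed.

Fact model_mulE i j k : bc e k (e i * e j) = M i j k.
Proof. by rewrite [e i * e j]model_mul_mbv bc_sum. Qed.

Fact mcop1 : mcop 1 = 1.
Proof.
have [a1 _ _ _ _] := aD; have e1 : 1 = e o :> A by [].
apply: (coord_inj (B := tbasis e e)) => -[j k].
by rewrite tensor1E tbasis_pure e1 mcop_coord !bcK a1.
Qed.

Fact mcopM : {morph mcop : u v / u * v}.
Proof.
have [_ _ _ _ a5] := aD.
move=> u v; move: u; apply: (linear_basis_ext (B := e)) => [k x y|k x y|i].
- by rewrite mulrDl -scalerAl mcop_linear.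
- by rewrite mcop_linear mulrDl -scalerAl.
move: v; apply: (linear_basis_ext (B := e)) => [k x y|k x y|j].
- by rewrite mulrDr -scalerAr mcop_linear.
- by rewrite mcop_linear mulrDr -scalerAr.
apply: (coord_inj (B := tbasis e e)) => -[k l].
rewrite tmul_coord [e i * e j]model_mul_mbv (linear_sum_fun mcop_linear) linear_sum.
under eq_bigr => x _ do rewrite
  (linearZ_fun mcop_linear) linearZ [bc _ _ _]mcop_coord.
rewrite a5; apply: eq_bigr => a _; apply: eq_bigr => b _.
rewrite mcop_coord; congr (_ * _); apply: eq_bigr => c _; apply: eq_bigr => d _.
by rewrite mcop_coord !model_mulE.
Qed.

Definition mcounit (u : A) : K^o := mcoord o u.

Fact mcounit_linear : linear mcounit.
Proof. by move=> a u v; rewrite /mcounit linearP. Qed.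

Fact mcounitM : {morph mcounit : u v / u * v}.
Proof.
have [_ _ a3 _] := aM.
move=> u v; move: u; apply: (linear_basis_ext (B := e)) => [k x y|k x y|i].
- by rewrite mulrDl -scalerAl mcounit_linear.
- by rewrite mcounit_linear mulrDl -scalerAl.
move: v; apply: (linear_basis_ext (B := e)) => [k x y|k x y|j].
- by rewrite mulrDr -scalerAr mcounit_linear.
- by rewrite mcounit_linear mulrDr -scalerAr.
by rewrite /mcounit [LHS]model_mulE a3 !mbcK ![o == _]eq_sym.
Qed.

Fact mcounit1 : mcounit 1 = 1.
Proof. by rewrite /mcounit mbcK eqxx. Qed.

HB.instance Definition _ := GRing.isLinear.Build _ _ _ _ mcop mcop_linear.
HB.instance Definition _ := GRing.isMonoidMorphism.Build _ _ mcop (mcop1, mcopM).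
HB.instance Definition _ := GRing.isLinear.Build _ _ _ _ mcounit mcounit_linear.
HB.instance Definition _ :=
  GRing.isMonoidMorphism.Build _ _ mcounit (mcounit1, mcounitM).

Fact mcopA u : tassoc (tmap mcop id (mcop u)) = tmap id mcop (mcop u).
Proof.
have [_ _ _ a4 _] := aD.
move: u; apply: (linear_basis_ext (B := e)) => [k x y|k x y|i].
- by rewrite mcop_linear tmap_linear tassoc_linear.
- by rewrite mcop_linear tmap_linear.
apply: (coord_inj (B := tbasis e (tbasis e e))) => -[a [b c]].
rewrite tassoc_coord (tmap_coord e e (tbasis e e) e) //; last exact: mcop_linear.
rewrite (tmap_coord e e e (tbasis e e)) //=; last exact: mcop_linear.
under eq_bigr => x _ do (under eq_bigr => y _ do rewrite !mcop_coord mbcK mulrA;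
  rewrite sum_deltar).
rewrite a4 exchange_big /=; apply: eq_bigr => y _.
by under [RHS]eq_bigr => x _ do rewrite !mcop_coord mbcK mulrCA; rewrite sum_deltal.
Qed.

Fact mcounit_bilinl : bilin (fun a b : A => mcounit a *: b).
Proof.
split=> w a x y; first by rewrite mcounit_linear scalerDl -scalerA.
by rewrite scalerDr !scalerA mulrC.
Qed.

Fact mcounit_bilinr : bilin (fun a b : A => mcounit b *: a).
Proof.
split=> w a x y; last by rewrite mcounit_linear scalerDl -scalerA.
by rewrite scalerDr !scalerA mulrC.
Qed.

Fact mcounitL u : tlift (fun a b => mcounit a *: b) (mcop u) = u.
Proof.
have [_ a2 _ _ _] := aD.
move: u; apply: (linear_basis_ext (B := e)) => [k x y|//|i].
  by rewrite mcop_linear tlift_is_linear.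
rewrite (tliftE e e); last exact: mcounit_bilinl.
rewrite (bigD1 o) //= [X in _ + X]big1 => [|j jo]; last first.
  rewrite big1 // => k _; rewrite /mcounit [mcoord _ _]mbcK eq_sym (negPf jo).
  by rewrite scale0r scaler0.
rewrite addr0 (bigD1 i) //= mcop_coord a2 eqxx scale1r /mcounit mbcK eqxx scale1r.
rewrite big1 ?addr0 // => k ki.
by rewrite [X in X *: _]mcop_coord a2 eq_sym (negPf ki) scale0r.
Qed.

Fact mcounitR u : tlift (fun a b => mcounit b *: a) (mcop u) = u.
Proof.
have [_ _ a3 _ _] := aD.
move: u; apply: (linear_basis_ext (B := e)) => [k x y|//|i].
  by rewrite mcop_linear tlift_is_linear.
rewrite (tliftE e e); last exact: mcounit_bilinr.
rewrite exchange_big (bigD1 o) //= [X in _ + X]big1 => [|j jo]; last first.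
  rewrite big1 // => k _; rewrite /mcounit [mcoord _ _]mbcK eq_sym (negPf jo).
  by rewrite scale0r scaler0.
rewrite addr0 (bigD1 i) //= mcop_coord a3 eqxx scale1r /mcounit mbcK eqxx scale1r.
rewrite big1 ?addr0 // => k ki.
by rewrite [X in X *: _]mcop_coord a3 eq_sym (negPf ki) scale0r.
Qed.

Lemma has_consts_model : exists H, has_consts o H M D /\ \dim {: H} = n.
Proof.
pose H := @Bialgebra K A mcop mcounit mcopA mcounitL mcounitR.
exists H; split; last exact: dim_model.
exists (e : basis H 'I_n); split=> //.
- by move=> i; rewrite /= /mcounit mbcK eq_sym.
- by move=> i j k; rewrite -model_mulE.
by move=> i j k; rewrite [LHS]mcop_coord.
Qed.

End Model.

(** * Antipodes and quasitriangular structures in coordinates *)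

Section Structures.
Variables (K : fieldType) (I : finType) (o : I) (H : bialgebra K) (B : basis H I).
Variables (M D : I -> I -> I -> K).
Hypothesis p : presents o B M D.
Local Notation BB := (tbasis B B).

Let p2 := let: And4 _ h _ _ := p in h.
Let p3 := let: And4 _ _ h _ := p in h.
Let p4 := let: And4 _ _ _ h := p in h.

Definition antipode_consts (S : I -> I -> K) :=
  (forall i l, \sum_a \sum_b D i a b * \sum_c M c b l * S a c =
    (i == o)%:R * (l == o)%:R) /\
  (forall i l, \sum_a \sum_b D i a b * \sum_c M a c l * S b c =
    (i == o)%:R * (l == o)%:R).

Lemma antipode_coordl (S : {linear H -> H}) i l :
  bc B l (tlift (fun a b => S a * b) (coprod H (B i))) =
  \sum_a \sum_b D i a b * \sum_c M c b l * bc B c (S (B a)).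
Proof.
rewrite (tliftE B B); last first.
  by split=> w a x y; rewrite ?linearP ?(mulrDl, mulrDr) -?(scalerAl, scalerAr).
rewrite linear_sum; apply: eq_bigr => a _; rewrite linear_sum;
  apply: eq_bigr => b _.
rewrite linearZ /= p4; congr (_ * _).
rewrite {1}(bvK B (S (B a))) mulr_suml linear_sum; apply: eq_bigr => c _.
by rewrite -scalerAl linearZ /= p3 mulrC.
Qed.

Lemma antipode_coordr (S : {linear H -> H}) i l :
  bc B l (tlift (fun a b => a * S b) (coprod H (B i))) =
  \sum_a \sum_b D i a b * \sum_c M a c l * bc B c (S (B b)).
Proof.
rewrite (tliftE B B); last first.
  by split=> w a x y; rewrite ?linearP ?(mulrDl, mulrDr) -?(scalerAl, scalerAr).
rewrite linear_sum; apply: eq_bigr => a _; rewrite linear_sum;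
  apply: eq_bigr => b _.
rewrite linearZ /= p4; congr (_ * _).
rewrite {1}(bvK B (S (B b))) mulr_sumr linear_sum; apply: eq_bigr => c _.
by rewrite -scalerAr linearZ /= p3 mulrC.
Qed.

Lemma counit1_coord i l : bc B l ((counit H (B i) : K)%:A) =
  (i == o)%:R * (l == o)%:R.
Proof. by rewrite linearZ /= (pres1 p) p2. Qed.

Lemma is_hopfE : is_hopf H <-> exists S, antipode_consts S.
Proof.
split=> [[S hS]|[S [hl hr]]].
  exists (fun a c => bc B c (S (B a))); split=> i l.
    by rewrite -antipode_coordl (hS _).1 counit1_coord.
  by rewrite -antipode_coordr (hS _).2 counit1_coord.
pose f (u : H) : H := \sum_a bc B a u *: \sum_c S a c *: B c.
have fl : linear f.
  move=> a u v; rewrite /f scaler_sumr -big_split; apply: eq_bigr => i _ /=.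
  by rewrite linearP scalerDl scalerA.
pose F : {linear H -> H} := HB.pack f (GRing.isLinear.Build _ _ _ _ f fl).
have FE a c : bc B c (F (B a)) = S a c.
  rewrite /= /f (bigD1 a) //= bcK eqxx scale1r [X in _ + X]big1 ?addr0
    ?bc_sum // => b ba.
  by rewrite bcK (negPf ba) scale0r.
have el : linear (fun h => (counit H h : K)%:A : H).
  by move=> a u v; rewrite linearP scalerDl scalerA.
exists F => h; split; move: h.
  apply: (linear_basis_ext (B := B)) => [a u v|//|i].
    by rewrite linearP tlift_is_linear.
  apply: (coord_inj (B := B)) => l; rewrite antipode_coordl counit1_coord -hl.
  by apply: eq_bigr => a _; apply: eq_bigr => b _; congr (_ * _);
    apply: eq_bigr => c _; rewrite FE.
apply: (linear_basis_ext (B := B)) => [a u v|//|i].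
  by rewrite linearP tlift_is_linear.
apply: (coord_inj (B := B)) => l; rewrite antipode_coordr counit1_coord -hr.
by apply: eq_bigr => a _; apply: eq_bigr => b _; congr (_ * _);
  apply: eq_bigr => c _; rewrite FE.
Qed.

(** The nesting of the sums copies [tmulc], so that the two can be matched term by term. *)
Definition tmul_consts (r s : I -> I -> K) k l :=
  \sum_a \sum_c M a c k * \sum_b \sum_e M b e l * (r a b * s c e).

Lemma tmulE (s t : tensor H H) k l :
  bc BB (k, l) (s * t) =
    tmul_consts (fun i j => bc BB (i, j) s) (fun i j => bc BB (i, j) t) k l.
Proof.
rewrite (tmul_coord B B); apply: eq_bigr => a _.
under eq_bigr => b _ do rewrite mulr_sumr.
rewrite exchange_big; apply: eq_bigr => c _ /=.
rewrite mulr_sumr; apply: eq_bigr => b _; rewrite !mulr_sumr; apply: eq_bigr => e _.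
by rewrite !p3; ring.
Qed.

Lemma tone_coord k l : bc BB (k, l) 1 = (k == o)%:R * (l == o)%:R.
Proof. by rewrite tensor1E tbasis_pure !(pres1 p). Qed.

Lemma tswap_coord (t : tensor H H) k l : bc BB (k, l) (tswap t) = bc BB (l, k) t.
Proof.
move: t; apply: (@tensor_ext _ _ _ K^o) => [a s t||u v].
- by rewrite [tswap _]tlift_is_linear linearP.
- exact: scalarP.
by rewrite /tswap tlift_pureE ?tbasis_pure /= 1?mulrC //; apply: swap_bilin.
Qed.

Lemma R13_bilin : bilin (fun a b : H => (a \ox (1 : H)) \ox b).
Proof.
by split=> w k u v;
  rewrite ?(oxl, oxr) ?(pure_bilin (tensor H H) H).1 ?(pure_bilin (tensor H H) H).2.
Qed.

Lemma R23_bilin : bilin (fun a b : H => ((1 : H) \ox a) \ox b).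
Proof.
by split=> w k u v;
  rewrite ?(oxl, oxr) ?(pure_bilin (tensor H H) H).1 ?(pure_bilin (tensor H H) H).2.
Qed.

Lemma R12_bilin : bilin (fun a b : H => (a \ox b) \ox (1 : H)).
Proof.
by split=> w k u v; rewrite ?(oxl, oxr) ?(pure_bilin (tensor H H) H).1.
Qed.

(** Gives [R12] the same form as [R13] and [R23], so that one coordinate formula for products serves
    both hexagon identities. *)
Lemma R12E (R : tensor H H) :
  R12 R = tlift (fun a b : H => (a \ox b) \ox (1 : H)) R.
Proof.
move: R; apply: tensor_ext => [a s t|a s t|u v].
- exact: (pure_bilin (tensor H H) H).1.
- exact: tlift_is_linear.
by rewrite tlift_pureE //; apply: R12_bilin.
Qed.

Lemma tlift_mul_coord (A : falgType K) (J : finType) (C : basis A J) (b b' : H ->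
  H -> A) (R : tensor H H) j :
  bilin b -> bilin b' ->
  bc C j (tlift b R * tlift b' R) =
  \sum_x \sum_y bc BB (x, y) R * \sum_z \sum_w bc BB (z, w) R *
    bc C j (b (B x) (B y) * b' (B z) (B w)).
Proof.
move=> bb bb'; rewrite (tliftE B B _ bb) mulr_suml linear_sum;
  apply: eq_bigr => x _.
rewrite mulr_suml linear_sum; apply: eq_bigr => y _; rewrite -scalerAl linearZ /=;
  congr (_ * _).
rewrite (tliftE B B _ bb') mulr_sumr linear_sum; apply: eq_bigr => z _.
rewrite mulr_sumr linear_sum; apply: eq_bigr => w _; by rewrite -scalerAr linearZ.
Qed.

Lemma hex1_coord (R : tensor H H) i j k : let r i j := bc BB (i, j) R in
  bc (tbasis BB B) ((i, j), k) (R13 R * R23 R) =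
    \sum_a \sum_b M a b k * (r i a * r j b).
Proof.
move=> r; rewrite tlift_mul_coord; [|exact: R13_bilin|exact: R23_bilin].
(* The first two slots of (a (x) 1 (x) b) (1 (x) a' (x) b') are a and a', with Kronecker deltas as
   coordinates; they collapse two of the four sums and leave the product b b' in the third slot. *)
transitivity (\sum_x (i == x)%:R *
  \sum_y r x y * \sum_z (j == z)%:R * \sum_w r z w * M y w k).
  apply: eq_bigr => x _; rewrite mulr_sumr; apply: eq_bigr => y _.
  rewrite mulrCA; congr (_ * _); rewrite mulr_sumr; apply: eq_bigr => z _.
  rewrite !mulr_sumr; apply: eq_bigr => w _.
  by rewrite !pure_tensorM mulr1 mul1r !tbasis_pure /= !bcK p3; ring.
rewrite sum_deltal; apply: eq_bigr => y _; rewrite sum_deltal mulr_sumr.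
by apply: eq_bigr => w _; ring.
Qed.

Lemma hex2_coord (R : tensor H H) i j k : let r i j := bc BB (i, j) R in
  bc (tbasis BB B) ((i, j), k) (R13 R * R12 R) =
    \sum_a \sum_b M a b i * (r a k * r b j).
Proof.
move=> r; rewrite R12E tlift_mul_coord; [|exact: R13_bilin|exact: R12_bilin].
transitivity (\sum_x \sum_y (k == y)%:R *
  (r x y * \sum_z \sum_w (j == w)%:R * (r z w * M x z i))).
  apply: eq_bigr => x _; apply: eq_bigr => y _.
  rewrite mulrCA; congr (_ * _); rewrite mulr_sumr; apply: eq_bigr => z _.
  rewrite !mulr_sumr; apply: eq_bigr => w _.
  by rewrite !pure_tensorM mulr1 mul1r !tbasis_pure /= !bcK p3; ring.
apply: eq_bigr => x _; rewrite sum_deltal mulr_sumr; apply: eq_bigr => z _.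
by rewrite sum_deltal; ring.
Qed.

Definition qt_consts (r : I -> I -> K) :=
  [/\ exists s, (forall k l, tmul_consts r s k l = (k == o)%:R * (l == o)%:R) /\
                (forall k l, tmul_consts s r k l = (k == o)%:R * (l == o)%:R),
      forall i j k, \sum_a D a i j * r a k =
        \sum_a \sum_b M a b k * (r i a * r j b),
      forall i j k, \sum_a D a j k * r i a = \sum_a \sum_b M a b i * (r a k * r b j)
    & forall h k l, tmul_consts r (D h) k l =
      tmul_consts (fun a b => D h b a) r k l].

Lemma tmul_consts_ext r r' s s' k l : r =2 r' -> s =2 s' ->
  tmul_consts r s k l = tmul_consts r' s' k l.
Proof.
move=> hr hs; rewrite /tmul_consts; apply: eq_bigr => a _; apply: eq_bigr => c _;
  congr (_ * _).
by apply: eq_bigr => b _; apply: eq_bigr => e _; rewrite hr hs.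
Qed.

Lemma quasitriangularE (R : tensor H H) :
  quasitriangular R <-> qt_consts (fun i j => bc BB (i, j) R).
Proof.
set r := fun i j => _.
have h1l i j k : bc (tbasis BB B) ((i, j), k) (tmap (coprod H) id R) =
  \sum_a D a i j * r a k.
  rewrite (tmap_coord B B) //; last exact: linearP.
  apply: eq_bigr => a _; rewrite -(sum_deltar (r a)) mulr_sumr.
  by apply: eq_bigr => c _; rewrite bcK p4; rewrite /r; ring.
have h2l i j k : bc (tbasis B BB) (i, (j, k)) (tmap id (coprod H) R) =
  \sum_a D a j k * r i a.
  rewrite (tmap_coord B B) //; last exact: linearP.
  rewrite exchange_big; apply: eq_bigr => a _ /=;
    rewrite -(sum_deltal (r^~ a) i) mulr_sumr.
  by apply: eq_bigr => c _; rewrite bcK p4; rewrite /r; ring.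
have h4l i k l : bc BB (k, l) (R * coprod H (B i)) = tmul_consts r (D i) k l.
  by rewrite tmulE; apply: tmul_consts_ext => // a b; rewrite p4.
have h4r i k l : bc BB (k, l) (tswap (coprod H (B i)) * R) =
  tmul_consts (fun a b => D i b a) r k l.
  by rewrite tmulE; apply: tmul_consts_ext => // a b; rewrite tswap_coord p4.
split=> [[q1 q2 q3 q4]|[[s [q1 q1']] q2 q3 q4]]; split.
- case/unitrP: q1 => X [hX hX']; exists (fun i j => bc BB (i, j) X).
  by split=> k l; rewrite -tmulE ?hX ?hX' tone_coord.
- by move=> i j k; rewrite -h1l q2 hex1_coord.
- by move=> i j k; rewrite -h2l q3 tassoc_coord hex2_coord.
- by move=> i k l; rewrite -h4l q4 h4r.
- pose X := \sum_q s q.1 q.2 *: BB q.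
  have Xc i j : bc BB (i, j) X = s i j by rewrite bc_sum.
  apply/unitrP; exists X; split; apply: (coord_inj (B := BB)) => -[k l];
    rewrite tmulE tone_coord.
    by rewrite -q1'; apply: tmul_consts_ext => // a b; rewrite Xc.
  by rewrite -q1; apply: tmul_consts_ext => // a b; rewrite Xc.
- by apply: (coord_inj (B := tbasis BB B)) => -[[i j] k]; rewrite h1l q2 hex1_coord.
- by apply: (coord_inj (B := tbasis B BB)) => -[i [j k]];
  rewrite h2l q3 tassoc_coord hex2_coord.
apply: (linear_basis_ext (B := B)) => [k x y|k x y|i].
- by rewrite linearP mulrDr -scalerAr.
- by rewrite linearP [tswap _]tlift_is_linear mulrDl -scalerAl.
by apply: (coord_inj (B := BB)) => -[k l]; rewrite h4l q4 h4r.
Qed.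

End Structures.

(** * Counting quasitriangular structures through coordinates *)

Section Counting.
Variables (K : finFieldType) (I : finType) (o : I).

(** Counts coordinate functions instead of tensors, which makes the number depend only on the
    constants; the excluded function is that of 1 (x) 1. *)
Definition num_qt_consts (M D : I -> I -> I -> K) : nat :=
  #|[set f : {ffun I * I -> K} | (f != [ffun q => (q.1 == o)%:R * (q.2 == o)%:R]) &&
      `[< qt_consts o M D (fun i j => f (i, j)) >]]|.

Lemma card_quasitriangular (H : bialgebra K) M D : has_consts o H M D ->
  #|[set R : tensor H H | (R != 1 \ox 1) && `[< quasitriangular R >]]| =
    num_qt_consts M D.
Proof.
case=> B p; pose BB := tbasis B B.
pose c (R : tensor H H) : {ffun I * I -> K} := [ffun q => bc BB q R].
pose d (f : {ffun I * I -> K}) : tensor H H := \sum_q f q *: BB q.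
have cK : cancel c d.
  by move=> R; rewrite [RHS](bvK BB); apply: eq_bigr => q _; rewrite ffunE.
have dK : cancel d c by move=> f; apply/ffunP => q; rewrite ffunE bc_sum.
rewrite -(card_imset _ (can_inj cK)) /num_qt_consts; apply: eq_card => f.
rewrite -[f]dK mem_imset ?inE; last exact: can_inj cK.
congr (~~ _ && _).
  apply/eqP/eqP => [->|e]; last apply: (can_inj cK); last rewrite e.
    by apply/ffunP => -[k l]; rewrite !ffunE -(tone_coord p).
  by apply/ffunP => -[k l]; rewrite !ffunE -(tone_coord p).
apply: asbool_equiv_eq; rewrite (quasitriangularE p).
suff -> : (fun i j => bc (tbasis B B) (i, j) (d f)) = (fun i j => c (d f) (i, j))
  by [].
by apply/funext => i; apply/funext => j; rewrite ffunE.
Qed.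

Lemma num_nontrivial_qtE N (H : 'I_N -> bialgebra K) :
  num_nontrivial_qt H =
  \sum_i #|[set R :
    tensor (H i) (H i) | (R != 1 \ox 1) && `[< quasitriangular R >]]|.
Proof.
rewrite /num_nontrivial_qt -sum1_card (partition_big (fun q => tag q) predT) //=.
apply: eq_bigr => i _; rewrite sum1_card.
have Ti : injective (fun t :
  tensor (H i) (H i) => Tagged (fun i => tensor (H i) (H i)) t).
  by move=> x y /eqP; rewrite eq_Tagged => /eqP.
rewrite -[RHS](card_imset _ Ti); apply: eq_card => -[j t].
apply/andP/imsetP => [[]|[t' ht' ->]].
  by rewrite inE /= => ht /eqP ji; subst j; exists t; rewrite ?inE.
by rewrite !inE in ht' *; rewrite ht' eqxx.
Qed.

End Counting.

(** * Counting isomorphism classes *)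

Section Invariants.
Variables (K : fieldType) (T : eqType) (hc : bialgebra K -> T -> Prop).
Hypothesis hc_isom : forall H H' r, hc H r -> hc H' r -> bialg_isom H H'.
Hypothesis isom_hc : forall H H' r, hc H r -> bialg_isom H H' -> hc H' r.
Variables (P : bialgebra K -> Prop) (rs : seq T).
Hypotheses (rs_uniq : uniq rs) (rs_real : forall r, r \in rs -> exists H, hc H r)
  (rs_P : forall H r, r \in rs -> hc H r -> P H)
  (P_rs : forall H, P H -> exists2 r, r \in rs & hc H r)
  (rs_sep : forall H r s, r \in rs -> s \in rs -> hc H r -> hc H s -> r = s).

Lemma num_isom_classes_invariant : num_isom_classes P (size rs).
Proof.
have [H hH] : exists H : 'I_(size rs) ->
  bialgebra K, forall i, hc (H i) (tnth (in_tuple rs) i).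
  apply: (@fin_all_exists _ (fun=> bialgebra K)
    (fun i A => hc A (tnth (in_tuple rs) i))) => i.
  by apply: rs_real; apply: mem_tnth.
exists H; split=> [i|i j ij|A PA].
- exact: rs_P (mem_tnth i (in_tuple rs)) (hH i).
- have e := rs_sep (mem_tnth i (in_tuple rs)) (mem_tnth j (in_tuple rs))
  (isom_hc (hH i) ij) (hH j).
  exact: (elimT (tuple_uniqP (in_tuple rs)) rs_uniq) e.
have [r /(tnthP (in_tuple rs))[i ->] hA] := P_rs PA.
by exists i; apply: hc_isom hA (hH i).
Qed.

(** Sending [i] to the value in [rs] attained by [H i] is a bijection onto [rs]: injective because
    the representatives are pairwise non-isomorphic, surjective because they are complete. The sum
    is therefore independent of their choice. *)
Lemma sum_representatives N (H : 'I_N -> bialgebra K) (q : bialgebra K -> nat) (c :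
  T -> nat) :
  representatives P H -> (forall A r, r \in rs -> hc A r -> q A = c r) ->
  \sum_i q (H i) = \sum_(r <- rs) c r.
Proof.
move=> [HP Hi HE] qc.
have [f hf] : exists f : 'I_N -> T, forall i, f i \in rs /\ hc (H i) (f i).
  apply: (@fin_all_exists _ (fun=> T) (fun i r => r \in rs /\ hc (H i) r)) => i.
  by have [r rr hr] := P_rs (HP i); exists r.
have f_inj : injective f.
  move=> i j e; apply: Hi; apply: (hc_isom (hf i).2); rewrite e; exact: (hf j).2.
have pf : perm_eq [seq f i | i <- enum 'I_N] rs.
  apply: uniq_perm => // [|r]; first by rewrite map_inj_uniq ?enum_uniq.
  apply/mapP/idP => [[i _ ->]|rr]; first exact: (hf i).1.
  have [A hA] := rs_real rr; have [i Ai] := HE A (rs_P rr hA).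
  exists i; first by rewrite mem_enum.
  exact: rs_sep rr (hf i).1 (isom_hc hA Ai) (hf i).2.
rewrite -(perm_big _ pf) big_map big_enum /=; apply: eq_bigr => i _.
exact: qc (hf i).1 (hf i).2.
Qed.

End Invariants.

Lemma num_isom_classes_or (K : fieldType) (P Q R : bialgebra K -> Prop) N N' :
  num_isom_classes P N -> num_isom_classes Q N' ->
  (forall A, R A <-> P A \/ Q A) ->
    (forall A B, P A -> Q B -> ~ bialg_isom A B /\ ~ bialg_isom B A) ->
  num_isom_classes R (N + N').
Proof.
move=> [H [HP Hi HE]] [H' [HP' Hi' HE']] RPQ sep.
exists (fun i => match split i with inl j => H j | inr j => H' j end).
split=> [i|i j|A /RPQ[/HE[i Ai]|/HE'[i Ai]]].
- by apply/RPQ; case: (split i) => j; [left|right].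
- case: (split_ordP i) => i' ->; case: (split_ordP j) => j' -> h.
  + by rewrite (Hi _ _ h).
  + by have [] := (sep _ _ (HP i') (HP' j')).1.
  + by have [] := (sep _ _ (HP j') (HP' i')).2.
  by rewrite (Hi' _ _ h).
- by exists (lshift N' i); rewrite (unsplitK (inl i)).
by exists (rshift N i); rewrite (unsplitK (inr i)).
Qed.

(** * Structure constants over F_2 as tables of bits *)

Local Notation F2 := 'F_2.

Section BitsToF2.

Lemma bitD a b : (oadd bops a b)%:R = a%:R + b%:R :> F2.
Proof. by apply/eqP; case: a; case: b. Qed.

Lemma bitM a b : (omul bops a b)%:R = a%:R * b%:R :> F2.
Proof. by apply/eqP; case: a; case: b. Qed.

Lemma bit_sum n F : (osum bops n F)%:R = \sum_(i < n) (F i)%:R :> F2.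
Proof.
rewrite -(big_mkord xpredT (fun i => (F i)%:R)) /index_iota subn0 /osum.
elim: (iota 0 n) => [|i s IH]; first by rewrite big_nil.
by rewrite big_cons -IH -bitD.
Qed.

Lemma bit_neq0 (x : F2) : x = (x != 0)%:R.
Proof. by case: x => -[|[|x]] //= hx; apply/val_inj. Qed.

(** Turns an equation encoded as the sum of its sides back into an equality in F_2. *)
Lemma bit_eq a b : ~~ oadd bops a b = (a%:R == b%:R :> F2).
Proof. by case: a; case: b. Qed.

Lemma bit_dlt n (i j : 'I_n) : dlt bops i j = (i == j).
Proof. by rewrite /dlt -[eqn i j]/(i == j); case: ifP. Qed.

Lemma bit_unit n (i j : 'I_n.+1) :
  (omul bops (dlt bops i 0) (dlt bops j 0))%:R =
    (i == ord0)%:R * (j == ord0)%:R :> F2.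
Proof. by rewrite bitM (bit_dlt i ord0) (bit_dlt j ord0). Qed.

End BitsToF2.

Ltac bits := repeat first
  [ done | rewrite bitM; congr (_ * _) | rewrite bit_sum; apply: eq_bigr => ? _ ].

Lemma zeros_cat s t : zeros (s ++ t) = zeros s && zeros t.
Proof. exact: all_cat. Qed.

Lemma all_flatten (T : Type) (p : pred T) ss : all p (flatten ss) = all (all p) ss.
Proof. by elim: ss => //= s ss IH; rewrite all_cat IH. Qed.

Lemma zeros_eqs2P F s1 s2 :
  reflect (forall i j, i \in s1 -> j \in s2 -> ~~ F i j) (zeros (eqs2 F s1 s2)).
Proof.
rewrite /zeros /eqs2 all_flatten all_map; apply: (iffP allP) => h i.
  by move=> j /h /=; rewrite all_map => /allP; apply.
by move=> i1 /=; rewrite all_map; apply/allP => j j2; apply: h.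
Qed.

Lemma zeros_eqs3P F s1 s2 s3 :
  reflect (forall i j k, i \in s1 -> j \in s2 -> k \in s3 ->
    ~~ F i j k) (zeros (eqs3 F s1 s2 s3)).
Proof.
rewrite /zeros /eqs3 all_flatten all_map; apply: (iffP allP) => h i.
  by move=> j k /h /=; rewrite -/(eqs2 _ _ _) -/(zeros _) => /zeros_eqs2P; apply.
by move=> i1 /=; rewrite -/(eqs2 _ _ _) -/(zeros _); apply/zeros_eqs2P => j k;
  apply: h.
Qed.

Lemma zeros_eqs4P F s1 s2 s3 s4 :
  reflect (forall i j k l, i \in s1 -> j \in s2 -> k \in s3 -> l \in s4 ->
    ~~ F i j k l) (zeros (eqs4 F s1 s2 s3 s4)).
Proof.
rewrite /zeros /eqs4 all_flatten all_map; apply: (iffP allP) => h i.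
  by move=> j k l /h /=; rewrite -/(eqs3 _ _ _ _) -/(zeros _) => /zeros_eqs3P;
    apply.
by move=> i1 /=; rewrite -/(eqs3 _ _ _ _) -/(zeros _); apply/zeros_eqs3P => j k l;
  apply: h.
Qed.

Section Dimension.
Variable m : nat.
Local Notation n := m.+1.
Local Notation o := (ord0 : 'I_n).
Implicit Types (M D : nat -> nat -> nat -> bool) (t d : tab3).

Definition toF3 M (i j k : 'I_n) : F2 := (M i j k)%:R.
Definition toF2 (g : nat -> nat -> bool) (i j : 'I_n) : F2 := (g i j)%:R.

Lemma ord_iota0 (i : 'I_n) : (i : nat) \in iota 0 n.
Proof. by rewrite mem_iota ltn_ord. Qed.

Lemma ord_iota1 (i : 'I_n) : i != o -> (i : nat) \in iota 1 m.
Proof. by rewrite mem_iota add1n ltn_ord andbT lt0n. Qed.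

Lemma iota0_ord i : i \in iota 0 n -> exists i' : 'I_n, i = i'.
Proof. by rewrite mem_iota => /= h; exists (Ordinal h). Qed.

Lemma iota1_ord i : i \in iota 1 m -> exists i' : 'I_n, i = i'.
Proof. by rewrite mem_iota add1n => /andP[_ h]; exists (Ordinal h). Qed.

Lemma assoc_eqnE M (i j k l : 'I_n) : ~~ assoc_eqn bops n M i j k l =
  (\sum_x toF3 M i j x * toF3 M x k l == \sum_x toF3 M j k x * toF3 M i x l).
Proof. by rewrite /assoc_eqn bit_eq; congr (_ == _); bits. Qed.

Lemma coassoc_eqnE D (i j k l : 'I_n) : ~~ coassoc_eqn bops n D i j k l =
  (\sum_x toF3 D i x l * toF3 D x j k == \sum_x toF3 D i j x * toF3 D x k l).
Proof. by rewrite /coassoc_eqn bit_eq; congr (_ == _); bits. Qed.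

Lemma compat_eqnE M D (i j k l : 'I_n) : ~~ compat_eqn bops n M D i j k l =
  (\sum_x toF3 M i j x * toF3 D x k l == \sum_a \sum_b toF3 D i a b * \sum_c \sum_e
     toF3 D j c e * (toF3 M a c k * toF3 M b e l)).
Proof.
rewrite /compat_eqn bit_eq; congr (_ == _); bits; rewrite bitM bit_sum mulr_sumr.
apply: eq_bigr => e _; rewrite bitM /toF3; ring.
Qed.

Lemma inv_eqnE g h (i j : 'I_n) : ~~ inv_eqn bops n g h i j =
  (\sum_x toF2 g i x * toF2 h x j == (i == j)%:R).
Proof. by rewrite /inv_eqn bit_eq bit_dlt; congr (_ == _); bits. Qed.

Lemma chgME g h M (i j k : 'I_n) :
  (chgM bops n g h M i j k)%:R = chM (toF2 g) (toF2 h) (toF3 M) i j k.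
Proof. by rewrite /chgM /chM; bits. Qed.

Lemma chgDE g h D (i j k : 'I_n) :
  (chgD bops n g h D i j k)%:R = chD (toF2 g) (toF2 h) (toF3 D) i j k.
Proof. by rewrite /chgD /chD; bits. Qed.

Lemma toF3_cM0l t (j k : 'I_n) : toF3 (cM bops t) o j k = (j == k)%:R.
Proof. by rewrite /toF3 -bit_dlt. Qed.

Lemma toF3_cM0r t (i k : 'I_n) : toF3 (cM bops t) i o k = (i == k)%:R.
Proof. by rewrite /toF3 -bit_dlt; case: i => -[|i] hi. Qed.

Lemma toF3_cM0 t (i j : 'I_n) : toF3 (cM bops t) i j o = (i == o)%:R * (j == o)%:R.
Proof. by apply/eqP; rewrite /toF3; case: i j => -[|i] hi [[|j] hj]. Qed.

Lemma toF3_cD0 d (j k : 'I_n) : toF3 (cD bops d) o j k = (j == o)%:R * (k == o)%:R.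
Proof. by apply/eqP; rewrite /toF3; case: j k => -[|j] hj [[|k] hk]. Qed.

Lemma toF3_cD0l d (i k : 'I_n) : toF3 (cD bops d) i o k = (i == k)%:R.
Proof. by rewrite /toF3 -bit_dlt. Qed.

Lemma toF3_cD0r d (i j : 'I_n) : toF3 (cD bops d) i j o = (i == j)%:R.
Proof.
by rewrite /toF3 -bit_dlt; case: j => -[|j] hj //; rewrite /= /dlt eqn_sym.
Qed.

(** When one of the three factors is the unit, both sides of associativity collapse to the same
    entry; the other instances are the listed equations. *)
Lemma alg_constsE t : alg_consts o (toF3 (cM bops t)) <->
  zeros (M_eqs m bops (cM bops t)).
Proof.
have c1 := toF3_cM0l t; have c2 := toF3_cM0r t; have c3 := toF3_cM0 t.
split=> [[_ _ _ a4]|/zeros_eqs4P z].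
  apply/zeros_eqs4P => i j k
    l /iota1_ord[i' ->] /iota1_ord[j' ->] /iota1_ord[k' ->] /iota0_ord[l' ->].
  by rewrite assoc_eqnE; apply/eqP/a4.
split=> // i j k l; have [->|i0] := eqVneq i o.
  under eq_bigr => x _ do rewrite c1.
  rewrite sum_deltal; under eq_bigr => x _ do rewrite c1 eq_sym.
  by rewrite sum_deltar.
have [->|j0] := eqVneq j o.
  under eq_bigr => x _ do rewrite c2.
  by rewrite sum_deltal; under eq_bigr => x _ do rewrite c1; rewrite sum_deltal.
have [->|k0] := eqVneq k o.
  under eq_bigr => x _ do rewrite c2 eq_sym.
  by rewrite sum_deltar; under eq_bigr => x _ do rewrite c2; rewrite sum_deltal.
by apply/eqP; rewrite -assoc_eqnE; apply: z; rewrite ?ord_iota0 ?ord_iota1.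
Qed.

(** Delta 1 = 1 (x) 1 settles coassociativity on the unit and, with the unit laws, multiplicativity
    of Delta when one factor is 1; the rest is listed. *)
Lemma coalg_constsE t d : coalg_consts o (toF3 (cM bops t)) (toF3 (cD bops d)) <->
  zeros (D_eqs m bops (cM bops t) (cD bops d)).
Proof.
have c1 := toF3_cM0l t; have c2 := toF3_cM0r t; have c3 := toF3_cM0 t.
have d1 := toF3_cD0 d; have d2 := toF3_cD0l d; have d3 := toF3_cD0r d.
rewrite /D_eqs zeros_cat;
  split=> [[_ _ _ a4 a5]|/andP[/zeros_eqs4P z /zeros_eqs4P z']].
  apply/andP; split; apply/zeros_eqs4P => i j k l.
    move=> /iota1_ord[i' ->] /iota1_ord[j' ->] /iota0_ord[k' ->] /iota0_ord[l' ->].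
    by rewrite compat_eqnE; apply/eqP/a5.
  move=> /iota1_ord[i' ->] /iota0_ord[j' ->] /iota0_ord[k' ->] /iota0_ord[l' ->].
  by rewrite coassoc_eqnE; apply/eqP/a4.
split=> //.
  move=> i a b c; have [->|i0] := eqVneq i o.
    under eq_bigr => x _ do rewrite d1 [x == o]eq_sym -mulrA.
    rewrite sum_deltal d1; under eq_bigr => x _ do rewrite d1 [x == o]eq_sym mulrAC.
    by rewrite sum_deltar d1; ring.
  by apply/eqP; rewrite -coassoc_eqnE; apply: z'; rewrite ?ord_iota0 ?ord_iota1.
move=> i j k l; have [->|i0] := eqVneq i o.
  under eq_bigr => x _ do rewrite c1.
  rewrite sum_deltal.
  under [RHS]eq_bigr => a _ do
    (under eq_bigr => b _ do rewrite d1 ![_ == o]eq_sym -mulrA;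
      rewrite -mulr_sumr sum_deltal).
  rewrite sum_deltal.
  under eq_bigr => c _ do
    (under eq_bigr => e _ do rewrite !c1 mulrA [e == l]eq_sym; rewrite sum_deltar).
  by under eq_bigr => c _ do rewrite [c == k]eq_sym; rewrite sum_deltar.
have [->|j0] := eqVneq j o.
  under eq_bigr => x _ do rewrite c2.
  rewrite sum_deltal.
  under [RHS]eq_bigr => a _ do under eq_bigr => b _ do
    (under eq_bigr => c _ do
       (under eq_bigr => e _ do rewrite d1 ![_ == o]eq_sym -mulrA;
         rewrite -mulr_sumr sum_deltal);
     rewrite sum_deltal !c2 mulrA [b == l]eq_sym).
  under [RHS]eq_bigr => a _ do rewrite sum_deltar [a == k]eq_sym.
  by rewrite sum_deltar.
by apply/eqP; rewrite -compat_eqnE; apply: z; rewrite ?ord_iota0 ?ord_iota1.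
Qed.

End Dimension.

Lemma zeros_cat5 a b c d e : zeros (a ++ b ++ c ++ d ++ e) =
  [&& zeros a, zeros b, zeros c, zeros d & zeros e].
Proof. by rewrite !zeros_cat. Qed.

Section TablesOfBialgebras.
Variable m : nat.
Local Notation n := m.+1.
Local Notation o := (ord0 : 'I_n).
Implicit Types (H : bialgebra F2) (t d : tab3) (gh : tab2 * tab2).

Definition has_tables H (r : tab3 * tab3) : Prop :=
  has_consts o H (@toF3 m (cM bops r.1)) (@toF3 m (cD bops r.2)).

(* The inverse of [toF3] on positive indices, shifted as in tables. *)
Definition natfun3 (M : 'I_n -> 'I_n -> 'I_n -> F2) i j k : bool :=
  M (inord i.+1) (inord j.+1) (inord k.+1) != 0.
Definition natfun2 (g : 'I_n -> 'I_n -> F2) i j : bool :=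
  g (inord i.+1) (inord j.+1) != 0.
(** Unshifted: antipodes and elements of H (x) H are stored with all their entries, including those
    of index 0. *)
Definition natfun2' (g : 'I_n -> 'I_n -> F2) i j : bool :=
  g (inord i) (inord j) != 0.

Lemma ord_case (i : 'I_n) : i = o \/ exists2 i', (i' < m)%N & i =
  inord i'.+1 /\ nat_of_ord i = i'.+1.
Proof.
case: i => -[|i] hi; first by left; apply/val_inj.
right; exists i => //; split=> //; by apply/val_inj; rewrite /= inordK.
Qed.

Lemma alg_consts_table M : alg_consts o M ->
  M = @toF3 m (cM bops (mk3 m (natfun3 M))).
Proof.
move=> [a1 a2 a3 _]; apply/funext => i; apply/funext => j; apply/funext => k.
have [->|[i' im [-> iE]]] := ord_case i; first by rewrite toF3_cM0l a1.
have [->|[j' jm [-> jE]]] := ord_case j; first by rewrite toF3_cM0r a2.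
have [->|[k' km [-> kE]]] := ord_case k; first by rewrite toF3_cM0 a3.
by rewrite {1}[M _ _ _]bit_neq0 /toF3 !inordK //= nth3_mk3.
Qed.

Lemma coalg_consts_table M D : coalg_consts o M D ->
  D = @toF3 m (cD bops (mk3 m (natfun3 D))).
Proof.
move=> [d1 d2 d3 _ _]; apply/funext => i; apply/funext => j; apply/funext => k.
have [->|[j' jm [-> jE]]] := ord_case j; first by rewrite toF3_cD0l d2.
have [->|[k' km [-> kE]]] := ord_case k; first by rewrite toF3_cD0r d3.
have [->|[i' im [-> iE]]] := ord_case i; first by rewrite toF3_cD0 d1.
by rewrite {1}[D _ _ _]bit_neq0 /toF3 !inordK //= nth3_mk3.
Qed.

Lemma unital_table g : unital o g -> g = @toF2 m (cG bops (mk2 m (natfun2 g))).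
Proof.
move=> [g1 g2]; apply/funext => i; apply/funext => j.
have [->|[i' im [-> iE]]] := ord_case i; first by rewrite g1 /toF2 -bit_dlt.
have [->|[j' jm [-> jE]]] := ord_case j.
  by rewrite g2 /toF2 -val_eqE /= inordK.
by rewrite {1}[g _ _]bit_neq0 /toF2 !inordK //= nth2_mk2.
Qed.

Lemma unital_cG g : unital o (@toF2 m (cG bops g)).
Proof.
split=> [j|i]; first by rewrite /toF2 -bit_dlt.
by rewrite /toF2; apply/eqP; case: i => -[|i] hi.
Qed.

Lemma table2E g : g = @toF2 m (nth2 bops (mk2 n (natfun2' g))).
Proof.
apply/funext => i; apply/funext => j.
by rewrite {1}[g _ _]bit_neq0 /toF2 nth2_mk2 // /natfun2' !inord_val.
Qed.

Lemma has_consts_tables H M D : has_consts o H M D ->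
  has_tables H (mk3 m (natfun3 M), mk3 m (natfun3 D)).
Proof.
move=> h; have [B p] := h.
by rewrite /has_tables -(alg_consts_table
  (presents_alg_consts p)) -(coalg_consts_table (presents_coalg_consts p)).
Qed.

Lemma has_tables_exists H : \dim {:H} = n ->
  exists F G, has_tables H (mk3 m F, mk3 m G).
Proof.
by move=> /has_consts_exists[M [D /has_consts_tables h]];
  exists (natfun3 M), (natfun3 D).
Qed.

Lemma has_tables_dim H r : has_tables H r -> \dim {:H} = n.
Proof. by case=> B _; exact: basis_dim B. Qed.

Lemma has_tables_isom H H' r : has_tables H r -> has_tables H' r -> bialg_isom H H'.
Proof. by move=> [B p] [B' p']; apply: presents_isom p p'. Qed.

Lemma isom_has_tables H H' r : has_tables H r -> bialg_isom H H' -> has_tables H' r.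
Proof. by move=> [B p] i; apply: (isom_presents p i). Qed.

Lemma has_tables_zeros H r : has_tables H r ->
  zeros (M_eqs m bops (cM bops r.1)) /\
    zeros (D_eqs m bops (cM bops r.1) (cD bops r.2)).
Proof.
move=> [B p]; split; first by apply/alg_constsE/(presents_alg_consts p).
by apply/coalg_constsE/(presents_coalg_consts p).
Qed.

Lemma has_tables_model r : zeros (M_eqs m bops (cM bops r.1)) ->
  zeros (D_eqs m bops (cM bops r.1) (cD bops r.2)) ->
  exists H, has_tables H r /\ \dim {:H} = n.
Proof.
by move=> /alg_constsE a /coalg_constsE c; apply: (has_consts_model a c).
Qed.

Lemma mutinvE g h : mutinv (@toF2 m (cG bops g)) (@toF2 m (cG bops h)) <->
  zeros (G_eqs m bops (cG bops g) (cG bops h)).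
Proof.
rewrite /G_eqs zeros_cat; split=> [[a b]|/andP[/zeros_eqs2P a /zeros_eqs2P b]].
  apply/andP; split; apply/zeros_eqs2P => i j /iota0_ord[i' ->] /iota0_ord[j' ->].
    by rewrite inv_eqnE; apply/eqP/a.
  by rewrite inv_eqnE; apply/eqP/b.
by split=> i j; apply/eqP; rewrite -inv_eqnE; [apply: a|apply: b]; apply: ord_iota0.
Qed.

Lemma newM_natfun3 gh t :
  newM m gh t = mk3 m
    (natfun3 (chM (@toF2 m (cG bops gh.1)) (@toF2 m (cG bops gh.2))
    (@toF3 m (cM bops t)))).
Proof.
apply: eq_mk3 => i j k im jm km; rewrite /natfun3 -chgME !inordK //.
by case: (chgM _ _ _ _ _ _ _ _).
Qed.

Lemma newD_natfun3 gh t :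
  newD m gh t = mk3 m
    (natfun3 (chD (@toF2 m (cG bops gh.1)) (@toF2 m (cG bops gh.2))
    (@toF3 m (cD bops t)))).
Proof.
apply: eq_mk3 => i j k im jm km; rewrite /natfun3 -chgDE !inordK //.
by case: (chgD _ _ _ _ _ _ _ _).
Qed.

Lemma has_tables_change H r gh : has_tables H r ->
  zeros (G_eqs m bops (cG bops gh.1) (cG bops gh.2)) ->
    has_tables H (newM m gh r.1, newD m gh r.2).
Proof.
move=> h /mutinvE gi; rewrite newM_natfun3 newD_natfun3; apply: has_consts_tables.
exact: has_consts_change h gi (unital_cG _).
Qed.

Lemma natfun3_toF3_cM t : mk3 m (natfun3 (@toF3 m (cM bops t))) =
  mk3 m (nth3 bops t).
Proof.
apply: eq_mk3 => i j k im jm km; rewrite /natfun3 /toF3 !inordK //=.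
by case: (nth3 _ _ _ _ _).
Qed.

Lemma natfun3_toF3_cD t : mk3 m (natfun3 (@toF3 m (cD bops t))) =
  mk3 m (nth3 bops t).
Proof.
apply: eq_mk3 => i j k im jm km; rewrite /natfun3 /toF3 !inordK //=.
by case: (nth3 _ _ _ _ _).
Qed.

(** Constants see only the entries in range, so the tables of [s] are recovered only after
    truncation by [mk3]; [is_mk3] later removes it. *)
Lemma has_tables_unique H r s : has_tables H r -> has_tables H s ->
  exists F G, let gh := (mk2 m F, mk2 m G) in
  [/\ zeros (G_eqs m bops (cG bops gh.1) (cG bops gh.2)),
      newM m gh r.1 = mk3 m (nth3 bops s.1) & newD m gh r.2 =
        mk3 m (nth3 bops s.2)].
Proof.
move=> hr hs; have [g [h [gi gu hu eM eD]]] := has_consts_unique hr hs.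
exists (natfun2 g), (natfun2 h); cbv zeta; rewrite newM_natfun3 newD_natfun3;
  cbn [fst snd].
rewrite -(unital_table gu) -(unital_table hu) -natfun3_toF3_cM -natfun3_toF3_cD;
  split.
- by apply/mutinvE; rewrite -(unital_table gu) -(unital_table hu).
- by congr (mk3 _ (natfun3 _)); apply/funext => i; apply/funext => j;
  apply/funext => k; rewrite eM.
by congr (mk3 _ (natfun3 _)); apply/funext => i; apply/funext => j;
  apply/funext => k; rewrite eD.
Qed.

Lemma antipode_constsE r s :
  antipode_consts o (@toF3 m (cM bops r.1)) (@toF3 m (cD bops r.2)) (@toF2 m s) <->
  zeros (S_eqs m bops (cM bops r.1) (cD bops r.2) s).
Proof.
have eL (i l : 'I_n) : ~~ hopfL bops n (cM bops r.1) (cD bops r.2) s i l =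
   (\sum_a \sum_b @toF3 m (cD bops r.2) i a b *
     \sum_c @toF3 m (cM bops r.1) c b l * @toF2 m s a c == (i == o)%:R *
     (l == o)%:R).
  by rewrite /hopfL bit_eq bit_unit; congr (_ == _); bits.
have eR (i l : 'I_n) : ~~ hopfR bops n (cM bops r.1) (cD bops r.2) s i l =
   (\sum_a \sum_b @toF3 m (cD bops r.2) i a b *
     \sum_c @toF3 m (cM bops r.1) a c l * @toF2 m s b c == (i == o)%:R *
     (l == o)%:R).
  by rewrite /hopfR bit_eq bit_unit; congr (_ == _); bits.
rewrite /S_eqs zeros_cat; split=> [[a b]|/andP[/zeros_eqs2P a /zeros_eqs2P b]].
  apply/andP; split; apply/zeros_eqs2P => i j /iota0_ord[i' ->] /iota0_ord[j' ->].
    by rewrite eL; apply/eqP/a.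
  by rewrite eR; apply/eqP/b.
by split=> i j; apply/eqP; rewrite -?eL -?eR; [apply: a|apply: b]; apply: ord_iota0.
Qed.

Lemma is_hopf_tables H r : has_tables H r ->
  is_hopf H <-> exists F,
    zeros (S_eqs m bops (cM bops r.1) (cD bops r.2) (nth2 bops (mk2 n F))).
Proof.
move=> [B p]; rewrite (is_hopfE p); split=> [[s]|[F /antipode_constsE]];
  last by exists (@toF2 m (nth2 bops (mk2 n F))).
by rewrite [s]table2E => /antipode_constsE; exists (natfun2' s).
Qed.

Lemma is_hopf_antipode H r s : has_tables H r ->
  zeros (S_eqs m bops (cM bops r.1) (cD bops r.2) s) -> is_hopf H.
Proof.
by move=> [B p] /antipode_constsE hs; rewrite (is_hopfE p); exists (@toF2 m s).
Qed.

Lemma tinvE t (r s : nat -> nat -> bool) (k l : 'I_n) :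
  ~~ tinv_eqn bops n (cM bops t) r s k l =
  (tmul_consts (@toF3 m (cM bops t)) (@toF2 m r) (@toF2 m s) k l == (k == o)%:R *
    (l == o)%:R).
Proof.
by rewrite /tinv_eqn bit_eq bit_unit; congr (_ == _); rewrite /tmulc /tmul_consts;
  bits.
Qed.

Lemma qt_constsE r F :
  qt_consts o (@toF3 m (cM bops r.1)) (@toF3 m (cD bops r.2))
  (@toF2 m (nth2 bops (mk2 n F))) <->
  exists G, zeros (R_eqs m bops (cM bops r.1) (cD bops r.2) (nth2 bops (mk2 n F))
    (nth2 bops (mk2 n G))).
Proof.
set R := nth2 bops (mk2 n F); set M := cM bops r.1; set D := cD bops r.2.
have e1 (i j k : 'I_n) : ~~ hex1 bops n M D R i j k =
  (\sum_a @toF3 m D a i j * @toF2 m R a k == \sum_a \sum_b @toF3 m M a b k *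
    (@toF2 m R i a * @toF2 m R j b)).
  by rewrite /hex1 bit_eq; congr (_ == _); bits.
have e2 (i j k : 'I_n) : ~~ hex2 bops n M D R i j k =
  (\sum_a @toF3 m D a j k * @toF2 m R i a == \sum_a \sum_b @toF3 m M a b i *
    (@toF2 m R a k * @toF2 m R b j)).
  by rewrite /hex2 bit_eq; congr (_ == _); bits.
have e3 (h k l : 'I_n) : ~~ qcomm bops n M D R h k l =
  (tmul_consts (@toF3 m M) (@toF2 m R) (@toF3 m D h) k l ==
   tmul_consts (@toF3 m M) (fun a b => @toF3 m D h b a) (@toF2 m R) k l).
  by rewrite /qcomm bit_eq; congr (_ == _); rewrite /tmulc /tmul_consts; bits.
rewrite /R_eqs; split=> [[[s [s1 s2]] q1 q2 q3]|[G]]; last first.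
  rewrite zeros_cat5 => /and5P[/zeros_eqs2P i1 /zeros_eqs2P i2 /zeros_eqs3P
    q1 /zeros_eqs3P q2 /zeros_eqs3P q3].
  split.
  - exists (@toF2 m (nth2 bops (mk2 n G))).
    by split=> k l; apply/eqP; rewrite -tinvE; [apply: i1|apply: i2];
      apply: ord_iota0.
  - by move=> i j k; apply/eqP; rewrite -e1; apply: q1; apply: ord_iota0.
  - by move=> i j k; apply/eqP; rewrite -e2; apply: q2; apply: ord_iota0.
  by move=> i j k; apply/eqP; rewrite -e3; apply: q3; apply: ord_iota0.
exists (natfun2' s); rewrite zeros_cat5; rewrite [s]table2E in s1 s2.
apply/and5P; split;
  [apply/zeros_eqs2P|apply/zeros_eqs2P|apply/zeros_eqs3P|apply/zeros_eqs3P|apply/zeros_eqs3P].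
- by move=> i j /iota0_ord[i' ->] /iota0_ord[j' ->]; rewrite tinvE; apply/eqP/s1.
- by move=> i j /iota0_ord[i' ->] /iota0_ord[j' ->]; rewrite tinvE; apply/eqP/s2.
- by move=> i j k /iota0_ord[i' ->] /iota0_ord[j' ->] /iota0_ord[k' ->];
  rewrite e1; apply/eqP/q1.
- by move=> i j k /iota0_ord[i' ->] /iota0_ord[j' ->] /iota0_ord[k' ->];
  rewrite e2; apply/eqP/q2.
by move=> i j k /iota0_ord[i' ->] /iota0_ord[j' ->] /iota0_ord[k' ->]; rewrite e3;
  apply/eqP/q3.
Qed.

(** Reading off bits is a bijection from functions with values in F_2 to tables of size n. The
    inverse [G] is quantified existentially, so each R is counted once. *)
Lemma num_qt_constsE r (rs : seq tab2) : uniq rs ->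
  (forall t : tab2, t \in rs -> exists F, t = mk2 n F) ->
  (forall F, (exists G,
    zeros (R_eqs m bops (cM bops r.1) (cD bops r.2) (nth2 bops (mk2 n F))
    (nth2 bops (mk2 n G))))
     <-> mk2 n F \in rs) ->
  num_qt_consts o (@toF3 m (cM bops r.1)) (@toF3 m (cD bops r.2)) =
    count (predC1 (unit_tab m)) rs.
Proof.
move=> urs rsmk rsE.
pose T (f : {ffun 'I_n * 'I_n -> F2}) := mk2 n (natfun2' (fun i j => f (i, j))).
pose U (t : tab2) : {ffun 'I_n * 'I_n -> F2} :=
  [ffun p : 'I_n * 'I_n => (nth2 bops t p.1 p.2)%:R].
have TK : cancel T U.
  by move=> f; apply/ffunP => -[i j];
    rewrite ffunE /= -[LHS]/(@toF2 m _ i j) -table2E.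
have UK F : T (U (mk2 n F)) = mk2 n F.
  apply: eq_mk2 => i j im jm; rewrite /natfun2' ffunE /= !inordK // nth2_mk2 //.
  by case: (F i j).
have unitE : T [ffun q => (q.1 == o)%:R * (q.2 == o)%:R] = unit_tab m.
  apply: eq_mk2 => i j im jm; rewrite /natfun2' ffunE /=.
  have := bit_unit (inord i : 'I_n) (inord j : 'I_n); rewrite !inordK // => <-.
  by rewrite -[RHS]/(omul bops (dlt bops i 0) (dlt bops j 0)); case: (omul _ _ _).
rewrite -size_filter -(size_map U) -(card_uniqP _); last first.
  rewrite map_inj_in_uniq ?filter_uniq // => x y.
  rewrite !mem_filter => /andP[_ /rsmk[F ->]] /andP[_ /rsmk[G ->]] e.
  by rewrite -UK e UK.
apply: eq_card => f; rewrite inE.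
have -> : `[< qt_consts o (@toF3 m (cM bops r.1)) (@toF3 m (cD bops r.2))
  (fun i j => f (i, j)) >] = (T f \in rs).
  apply/asboolP/idP;
    first by rewrite [X in qt_consts _ _ _ X]table2E => /qt_constsE/rsE.
  by move/rsE/qt_constsE; rewrite -table2E.
apply/andP/mapP => [[f1 frs]|[t]].
  exists (T f); last by rewrite TK.
  by rewrite mem_filter frs andbT /= -unitE (inj_eq (can_inj TK)).
rewrite mem_filter /= => /andP[t1 trs] ->; have [F tF] := rsmk _ trs; subst t.
by rewrite UK trs -(inj_eq (can_inj TK)) UK unitE.
Qed.

End TablesOfBialgebras.

(** * The certified classification *)

Section Certified.
Variables (m : nat) (c : cert).
Hypothesis c_ok : check_cert m c.
Local Notation n := m.+1.
Implicit Types H : bialgebra F2.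

Lemma reps_group r : r \in reps c -> exists2 g, g \in mult_groups c & r.1 =
  mult_of g /\ r.2 \in comults_of g.
Proof. by move=> /flattenP[_ /mapP[g gc ->] /mapP[d dg ->]]; exists g. Qed.

Lemma group_reps g d : g \in mult_groups c -> d \in comults_of g ->
  (mult_of g, d) \in reps c.
Proof.
by move=> gc dg; apply/flattenP; exists [seq (mult_of g, d) | d <- comults_of g];
  apply: map_f.
Qed.

Lemma zeros_swap gh : zeros (G_eqs m bops (cG bops gh.1) (cG bops gh.2)) ->
  zeros (G_eqs m bops (cG bops (swap gh).1) (cG bops (swap gh).2)).
Proof. by rewrite /G_eqs !zeros_cat andbC. Qed.

(** Two changes of basis are made: one brings the product into the list, the next brings the
    resulting coproduct into the list of that product. *)
Lemma cert_complete H : \dim {:H} = n -> exists2 r, r \in reps c & has_tables m H r.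
Proof.
have /and5P[/andP[/allP gz _] cMok /andP[/eqP multsE /allP cDok] _ _] := c_ok.
move=> /has_tables_exists[F [G h]]; have [zM _] := has_tables_zeros h.
have [k [w [gk hw]]] := check_sound cMok (etrans (M_sysE m F) zM).
move: gk; case: ifP => // ks; rewrite (w3_env hw) -multsE => /mapP[g gc Mg].
have h1 := has_tables_change h (zeros_swap (gz _ (mem_nth ([::], [::]) ks))).
have {}h1 : has_tables m H (mult_of g, newD m (swap (gl_nth c k)) (mk3 m G))
  by rewrite -Mg.
(* The transported coproduct is put in the form [mk3 m D], a point at which the second polynomial
   system can be evaluated. *)
have [_ zD] := has_tables_zeros h1; rewrite newD_natfun3 in h1 zD.
set D := natfun3 _ in h1 zD.
have [k' [w' [gk' hw']]] := check_sound (cDok _ gc) (etrans (D_sysE m _ _) zD).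
move: gk'; case: ifP => // ks'; cbv zeta; case: eqP => // gMM;
  rewrite (w3_env hw') => Dg.
(* By [gMM] the second change of basis is an automorphism of the algebra, so the normalised product
   survives it. *)
have h2 := has_tables_change h1 (zeros_swap (gz _ (mem_nth ([::], [::]) ks'))).
have {}h2 : has_tables m H (mult_of g, newD m (swap (gl_nth c k')) (mk3 m D))
  by rewrite -{1}gMM.
by exists (mult_of g, newD m (swap (gl_nth c k')) (mk3 m D)) => //;
  apply: group_reps.
Qed.

Lemma cert_real r : r \in reps c -> exists H, has_tables m H r /\ \dim {:H} = n.
Proof.
have /and5P[_ _ _ _ /andP[/allP cv _]] := c_ok.
case: r => M d /reps_group[g /cv gv [/= -> dg]].
apply: has_tables_model; move: gv; rewrite /=;
  case: (comults_of g) dg => // d' s dg /andP[zM /allP zD] //.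
exact: zD.
Qed.

(** Two tables of the same bialgebra differ by a matrix, which the tree for GL_m locates in the
    list; the separation test for this matrix then identifies the tables. *)
Lemma cert_sep H r s : r \in reps c -> s \in reps c ->
  has_tables m H r -> has_tables m H s -> r = s.
Proof.
have /and5P[/andP[_ cG] _ _ /allP cs /and3P[_ /allP wf _]] := c_ok.
case: r s => M d
  [M' d'] /reps_group[g gc [/= -> dg]] /reps_group[g' gc' [/= -> dg']] hr hs.
have [F [G [gz eM eD]]] := has_tables_unique hr hs.
have [k [w [wc hw]]] := check_sound cG (etrans (G_sysE m F G) gz).
rewrite /G_of_word (w2_envl hw) (w2_envr hw) in wc.
have /andP[/eqP wM /allP wD] := wf _ gc'.
rewrite -wM in eM; rewrite -(eqP (wD _ dg')) in eD.
(* The members [dg] and [dg'] rule out the skipped case of an empty list of coproducts. *)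
have /allP/(_ _ gc) := cs _ wc; case E : (comults_of g) dg => [|d0 s0] //;
  rewrite -E => dg {E}.
move=> /allP/(_ _ gc'); case E : (comults_of g') dg' => [|d0' s0'] //;
  rewrite -E => dg' {E}.
rewrite eM eqxx => /andP[/eqP -> /allP/(_ _ dg)/allP/(_ _ dg')].
by rewrite eD eqxx => /eqP ->.
Qed.

Lemma cert_uniq : uniq (reps c).
Proof. by have /and5P[_ _ _ _ /and3P[_ _ ->]] := c_ok. Qed.

Lemma num_bialgebras :
  num_isom_classes (fun H : bialgebra F2 => \dim {:H} = n) (size (reps c)).
Proof.
apply: (num_isom_classes_invariant (hc := has_tables m)).
- exact: has_tables_isom.
- exact: isom_has_tables.
- exact: cert_uniq.
- by move=> r /cert_real[H [h _]]; exists H.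
- by move=> H r _; apply: has_tables_dim.
- exact: cert_complete.
exact: cert_sep.
Qed.

Variable hl : seq (tab3 * tab3 * hopf_cert).
Hypothesis hl_ok : check_hopfs m (reps c) hl.

Lemma check_hopfP H r hc : check_hopf m r hc -> has_tables m H r -> is_hopf H <->
  has_antipode hc.
Proof.
case: hc => [s ws t /and4P[zs _ _ _]|t ct] h; split=> //=.
  by move=> _; apply: is_hopf_antipode h zs.
move=> /(is_hopf_tables h)[F zS].
by have [x [w []]] := check_sound ct (etrans (S_sysE m r F) zS).
Qed.

Lemma check_hopf_num_R r hc : check_hopf m r hc -> has_antipode hc ->
  num_qt_consts ord0 (@toF3 m (cM bops r.1)) (@toF3 m (cD bops r.2)) = num_R m hc.
Proof.
case: hc => // s ws t /and4P[_ /allP zR uR cR] _.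
rewrite (num_qt_constsE (rs := map (w2 n 0) ws)) //; first by rewrite count_map.
  by move=> _ /mapP[w _ ->]; exists (fun i j => nth false w (0 + (i * n + j))%N).
move=> F; split=> [[G zs]|/mapP[w /zR ww wF]].
  have [x [w [wr hw]]] := check_sound cR (etrans (R_sysE m r F G) zs).
  by rewrite -(w2_envl hw).
by exists (fun i j => nth false w (n * n + (i * n + j))%N); rewrite wF.
Qed.

Lemma hopf_repsP r :
  reflect (exists2 hc, (r, hc) \in hl & has_antipode hc) (r \in hopf_reps hl).
Proof.
apply: (iffP mapP) => [[[s hc]]|[hc rh ah]].
  by rewrite mem_filter /= => /andP[ah sh] ->; exists hc.
by exists (r, hc) => //; rewrite mem_filter /= ah.
Qed.

Lemma hl_reps r hc : (r, hc) \in hl -> r \in reps c /\ check_hopf m r hc.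
Proof.
move=> rh; have /andP[/eqP <- /allP ch] := hl_ok.
by split; [apply: (map_f fst rh)|apply: ch rh].
Qed.

Lemma hopf_reps_reps r : r \in hopf_reps hl -> r \in reps c.
Proof. by case/hopf_repsP => hc /hl_reps[]. Qed.

Lemma hopf_reps_uniq : uniq (hopf_reps hl).
Proof.
have /andP[/eqP hr _] := hl_ok; have := cert_uniq; rewrite -hr.
by apply: subseq_uniq; apply/map_subseq/filter_subseq.
Qed.

Lemma hopf_reps_hopf H r : r \in hopf_reps hl -> has_tables m H r ->
  hopf_of_dim n H.
Proof.
case/hopf_repsP => hc /hl_reps[_ ch] ah h; split; last exact: has_tables_dim h.
by apply/(check_hopfP ch h).
Qed.

Lemma hopf_reps_complete H : hopf_of_dim n H ->
  exists2 r, r \in hopf_reps hl & has_tables m H r.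
Proof.
move=> [hH /cert_complete[r rr h]]; exists r => //; have /andP[/eqP hr _] := hl_ok.
move: rr; rewrite -{1}hr => /mapP[[s hc] rh /= e]; subst s.
by apply/hopf_repsP; exists hc => //; apply/(check_hopfP (hl_reps rh).2 h).
Qed.

Lemma hopf_reps_sep H r s : r \in hopf_reps hl -> s \in hopf_reps hl ->
  has_tables m H r -> has_tables m H s -> r = s.
Proof. by move=> /hopf_reps_reps rr /hopf_reps_reps; apply: cert_sep. Qed.

Lemma hopf_reps_real r : r \in hopf_reps hl -> exists H, has_tables m H r.
Proof. by move=> /hopf_reps_reps/cert_real[H [h _]]; exists H. Qed.

Lemma num_hopf_algebras :
  num_isom_classes (@hopf_of_dim F2 n) (size (hopf_reps hl)).
Proof.
apply: (num_isom_classes_invariant (hc := has_tables m)).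
- exact: has_tables_isom.
- exact: isom_has_tables.
- exact: hopf_reps_uniq.
- exact: hopf_reps_real.
- exact: hopf_reps_hopf.
- exact: hopf_reps_complete.
exact: hopf_reps_sep.
Qed.

Lemma num_quasitriangular N (H : 'I_N -> bialgebra F2) :
  representatives (@hopf_of_dim F2 n) H ->
  num_nontrivial_qt H = sumn [seq num_R m xh.2 | xh <- hl].
Proof.
move=> HR; rewrite num_nontrivial_qtE.
pose q (A : bialgebra F2) :=
  #|[set R : tensor A A | (R != 1 \ox 1) && `[< quasitriangular R >]]|.
pose nq (r : tab3 * tab3) :=
  num_qt_consts ord0 (@toF3 m (cM bops r.1)) (@toF3 m (cD bops r.2)).
have qE A r : r \in hopf_reps hl -> has_tables m A r -> q A = nq r.
  by move=> _; apply: card_quasitriangular.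
rewrite (sum_representatives (@has_tables_isom m)
  (@isom_has_tables m) hopf_reps_uniq
  hopf_reps_real hopf_reps_hopf hopf_reps_complete hopf_reps_sep HR qE).
(* Entries without antipode are filtered out on one side and contribute 0 on the other. *)
rewrite sumnE big_map /hopf_reps big_map big_filter big_mkcond.
apply: eq_big_seq => -[r hc] /hl_reps[_ ch] /=; case: ifP => ah;
  first exact: check_hopf_num_R.
by case: hc ah {ch}.
Qed.

End Certified.

(** * Dimensions 2, 3 and 4 *)

Lemma isom_dim (A B : bialgebra F2) : (0 < \dim {:A})%N -> bialg_isom A B ->
  \dim {:B} = \dim {:A}.
Proof.
(* Isomorphic bialgebras share their tables, and the format of the tables fixes the dimension as
   [k.+1]. *)
case dA: (\dim {:A}) => [|k] // _ AB; have [F [G h]] := has_tables_exists dA.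
exact: has_tables_dim (isom_has_tables h AB).
Qed.

Lemma num_isom_classes_dim234 (P : nat -> bialgebra F2 -> Prop) (R :
  bialgebra F2 -> Prop) N2 N3 N4 :
  (forall k A, P k A -> \dim {:A} = k) ->
  (forall A, R A <-> (P 2 A \/ P 3 A) \/ P 4 A) ->
  num_isom_classes (P 2) N2 -> num_isom_classes (P 3) N3 ->
    num_isom_classes (P 4) N4 ->
  num_isom_classes R (N2 + N3 + N4).
Proof.
move=> Pd RP h2 h3 h4.
have sep A B j k : (0 < j)%N -> (0 < k)%N -> j <> k -> P j A -> P k B ->
  ~ bialg_isom A B /\ ~ bialg_isom B A.
  move=> j0 k0 jk /Pd dA /Pd dB.
  by split=> /isom_dim; rewrite dA dB => e; apply: jk; rewrite e.
apply: num_isom_classes_or h4 RP _.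
  apply: num_isom_classes_or h2 h3 _ _ => [A|A B]; first by split; apply.
  exact: sep.
by move=> A B [] PA PB; [apply: (sep A B 2 4)|apply: (sep A B 3 4)].
Qed.

(** The argument is the dimension of the kernel of the counit, one less than that of the bialgebra.
    Storing the evaluated certificate leaves only its verification to the proofs below. *)
Definition cert_dim2 : cert := Eval vm_compute in find_cert 1.
Definition cert_dim3 : cert := Eval vm_compute in find_cert 2.
Definition cert_dim4 : cert := Eval vm_compute in find_cert 3.
Definition hopf_dim2 := Eval vm_compute in find_hopf_certs 1 (reps cert_dim2).
Definition hopf_dim3 := Eval vm_compute in find_hopf_certs 2 (reps cert_dim3).
Definition hopf_dim4 := Eval vm_compute in find_hopf_certs 3 (reps cert_dim4).

Lemma cert_dim2_ok : check_cert 1 cert_dim2.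
Proof. vm_cast_no_check (erefl true). Qed.
Lemma cert_dim3_ok : check_cert 2 cert_dim3.
Proof. vm_cast_no_check (erefl true). Qed.
Lemma cert_dim4_ok : check_cert 3 cert_dim4.
Proof. vm_cast_no_check (erefl true). Qed.
Lemma hopf_dim2_ok : check_hopfs 1 (reps cert_dim2) hopf_dim2.
Proof. vm_cast_no_check (erefl true). Qed.
Lemma hopf_dim3_ok : check_hopfs 2 (reps cert_dim3) hopf_dim3.
Proof. vm_cast_no_check (erefl true). Qed.
Lemma hopf_dim4_ok : check_hopfs 3 (reps cert_dim4) hopf_dim4.
Proof. vm_cast_no_check (erefl true). Qed.

Lemma num_bialgebras_dim2 :
  num_isom_classes (fun H : bialgebra F2 => \dim {:H} = 2%N) 4.
Proof. exact: (num_bialgebras cert_dim2_ok). Qed.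
Lemma num_bialgebras_dim3 :
  num_isom_classes (fun H : bialgebra F2 => \dim {:H} = 3%N) 24.
Proof. exact: (num_bialgebras cert_dim3_ok). Qed.
Lemma num_bialgebras_dim4 :
  num_isom_classes (fun H : bialgebra F2 => \dim {:H} = 4%N) 286.
Proof.
have e : size (reps cert_dim4) = 286%N by vm_compute.
by have := num_bialgebras cert_dim4_ok; rewrite e.
Qed.
Lemma num_hopf_dim2 : num_isom_classes (@hopf_of_dim F2 2) 3.
Proof.
have e : size (hopf_reps hopf_dim2) = 3%N by vm_compute.
by have := num_hopf_algebras cert_dim2_ok hopf_dim2_ok; rewrite e.
Qed.
Lemma num_hopf_dim3 : num_isom_classes (@hopf_of_dim F2 3) 2.
Proof.
have e : size (hopf_reps hopf_dim3) = 2%N by vm_compute.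
by have := num_hopf_algebras cert_dim3_ok hopf_dim3_ok; rewrite e.
Qed.
Lemma num_hopf_dim4 : num_isom_classes (@hopf_of_dim F2 4) 20.
Proof.
have e : size (hopf_reps hopf_dim4) = 20%N by vm_compute.
by have := num_hopf_algebras cert_dim4_ok hopf_dim4_ok; rewrite e.
Qed.

Theorem mainTheorem1 :
  [/\ (* (a) *)
      [/\ num_isom_classes (fun H : bialgebra 'F_2 => \dim {:H} = 2%N) 4,
          num_isom_classes (fun H : bialgebra 'F_2 => \dim {:H} = 3%N) 24,
          num_isom_classes (fun H : bialgebra 'F_2 => \dim {:H} = 4%N) 286
        & num_isom_classes
            (fun H : bialgebra 'F_2 => (2 <= \dim {:H} <= 4)%N) 314],
      (* (b) *)
      [/\ num_isom_classes (@hopf_of_dim 'F_2 2) 3,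
          num_isom_classes (@hopf_of_dim 'F_2 3) 2,
          num_isom_classes (@hopf_of_dim 'F_2 4) 20
        & num_isom_classes
            (fun H : bialgebra 'F_2 => is_hopf H /\ (2 <= \dim {:H} <= 4)%N) 25]
    & (* (c) *)
      [/\ forall (N : nat) (H : 'I_N -> bialgebra 'F_2),
            representatives (@hopf_of_dim 'F_2 2) H ->
            num_nontrivial_qt H = 1%N,
          forall (N : nat) (H : 'I_N -> bialgebra 'F_2),
            representatives (@hopf_of_dim 'F_2 3) H ->
            num_nontrivial_qt H = 0%N
        & forall (N : nat) (H : 'I_N -> bialgebra 'F_2),
            representatives (@hopf_of_dim 'F_2 4) H ->
            num_nontrivial_qt H = 28%N]].
Proof.
have dims k : (2 <= k <= 4)%N <-> (k = 2%N \/ k = 3%N) \/ k = 4%N.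
  by split=> [|[[]|] -> //]; case: k => [|[|[|[|[|k]]]]] //; auto.
split; split.
- exact: num_bialgebras_dim2.
- exact: num_bialgebras_dim3.
- exact: num_bialgebras_dim4.
- apply: (num_isom_classes_dim234 (P :=
  fun k A => \dim {:A} =
  k) _ _ num_bialgebras_dim2 num_bialgebras_dim3 num_bialgebras_dim4) => //.
- exact: num_hopf_dim2.
- exact: num_hopf_dim3.
- exact: num_hopf_dim4.
- apply: (num_isom_classes_dim234 (P :=
  @hopf_of_dim F2) _ _ num_hopf_dim2 num_hopf_dim3 num_hopf_dim4) => [k A []//|A].
  by split=> [[hA /dims]|[[]|] [hA d]]; rewrite /hopf_of_dim;
    [tauto|split=> //; rewrite d..].
- by move=> N H /(num_quasitriangular cert_dim2_ok hopf_dim2_ok) ->; vm_compute.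
- by move=> N H /(num_quasitriangular cert_dim3_ok hopf_dim3_ok) ->; vm_compute.
by move=> N H /(num_quasitriangular cert_dim4_ok hopf_dim4_ok) ->; vm_compute.
Qed.
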